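(* For any $\alpha\ge2$ and $F_t\in\mathbb A_t^{[\alpha]}\langle\langle z\rangle\rangle$, the differential operator specialization $\mathcal S_{F_t}$ is a graded $K$-Hopf algebra homomorphism $\mathcal S_{F_t}:\mathcal N\mathrm{Sym}\to\mathcal D^{[\alpha]}\langle z\rangle\subset\mathcal D^{[\alpha]}\langle\langle z\rangle\rangle$ if and only if $F_t\in\mathbb G_t^{[\alpha]}\langle\langle z\rangle\rangle$.
   Context: Setup. $K$ is a unital commutative $\mathbb Q$-algebra, $z=(z_1,\dots,z_n)$ ($n\ge 1$) are independent variables, either commutative or noncommutative (free); statements hold in both cases and the same notation is used for both. $t$ is a formal parameter commuting with everything. $K\langle z\rangle$ is the polynomial algebra in $z$ over $K$; $K\langle\langle z\rangle\rangle$ and $K[[t]]\langle\langle z\rangle\rangle$ are the formal power series algebras in $z$ over $K$ and $K[[t]]$. $o(u)$ is the lowest degree in $z$ of the monomials occurring in $u$ (for a vector, the minimum over its components). $\mathcal Der^{[\alpha]}\langle\langle z\rangle\rangle$ is the set of $K$-derivations of $K\langle\langle z\rangle\rangle$ that increase the degree in $z$ by at least $\alpha-1$ (i.e. those sending each $z_i$ to some $u_i$ with $o(u_i)\ge\alpha$), and $\mathcal D^{[\alpha]}\langle\langle z\rangle\rangle$ is the unital subalgebra of $\mathrm{End}_K(K\langle\langle z\rangle\rangle)$ generated by $\mathcal Der^{[\alpha]}\langle\langle z\rangle\rangle$. $\mathcal D\langle z\rangle$ is the unital subalgebra of $\mathrm{End}_K(K\langle z\rangle)$ generated by all $K$-derivations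 of $K\langle z\rangle$, and $\mathcal D^{[\alpha]}\langle z\rangle:=\mathcal D\langle z\rangle\cap\mathcal D^{[\alpha]}\langle\langle z\rangle\rangle$. Hopf structure on differential operators (the paper's convention): the algebra generated by derivations is identified with the universal enveloping algebra of the Lie algebra of derivations, and carries the corresponding $K$-Hopf algebra structure, determined on derivations $\delta$ by $\Delta(\delta)=1\otimes\delta+\delta\otimes1$, $S(\delta)=-\delta$, $\epsilon(\delta)=\delta\cdot1$ $(=0)$. Gradings. For $m\ge0$, $\mathcal D_{[m]}\langle z\rangle$ is the set of $U\in\mathcal D\langle z\rangle$ such that for every homogeneous polynomial $h(z)$ of degree $d\ge0$, $Uh(z)$ is zero or homogeneous of degree $m+d$. $\mathcal D^{[\alpha]}\langle z\rangle$ is graded with degree-$m$ component $\mathcal D_{[m]}\langle z\rangle\cap\mathcal D^{[\alpha]}\langle z\rangle$ (scalars in degree $0$). $\mathcal N\mathrm{Sym}=K\langle\Lambda\rangle$ is the free associative $K$-algebra on $\Lambda_m$ ($m\ge1$), graded by giving $\Lambda_m$ weight $m$; it is a $K$-Hopf algebra in which, with $\Lambda_0=1$, $\lambda(t)=\sum_{m\ge0}t^m\Lambda_m$, $\sigma(t)=\lambda(-t)^{-1}$ and $\Psi_m$ defined by $\frac{d\sigma(t)}{dt}=\sigma(t)\sum_{m\ge1}t^{m-1}\Psi_m$, each $\Psi_m$ is primitive ($\Delta(\Psi_m)=1\otimes\Psi_m+\Psi_m\otimes1$, $\epsilon(\Psi_m)=0$, $S(\Psi_m)=-\Psi_m$).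 Automorphisms. $\mathbb A_t^{[\alpha]}\langle\langle z\rangle\rangle$ is the set of automorphisms $F_t(z)=z-H_t(z)$ of $K[[t]]\langle\langle z\rangle\rangle$ over $K[[t]]$ with $H_t(z)\in K[[t]]\langle\langle z\rangle\rangle^{\times n}$, $o(H_t(z))\ge\alpha$ and $H_{t=0}(z)=0$. $\mathbb G_t^{[\alpha]}\langle\langle z\rangle\rangle$ (for $\alpha\ge2$) is the subgroup of those $F_t\in\mathbb A_t^{[\alpha]}\langle\langle z\rangle\rangle$ such that $F_t(z)=t^{-1}F(tz)$ for some automorphism $F(z)$ of $K\langle\langle z\rangle\rangle$. Specialization. For $F_t\in\mathbb A_t^{[\alpha]}\langle\langle z\rangle\rangle$, let $\lambda_m\in\mathcal D^{[\alpha]}\langle\langle z\rangle\rangle$ ($m\ge0$, $\lambda_0=1$) be the unique sequence such that $\big(\sum_{m\ge0}(-1)^mt^m\lambda_m\big)u_t(z)=u_t(F_t(z))$ for all $u_t\in K[[t]]\langle\langle z\rangle\rangle$. The differential operator specialization $\mathcal S_{F_t}:\mathcal N\mathrm{Sym}\to\mathcal D^{[\alpha]}\langle\langle z\rangle\rangle$ is the unique $K$-algebra homomorphism with $\mathcal S_{F_t}(\Lambda_m)=\lambda_m$ for all $m\ge1$ (it is a $K$-Hopf algebra homomorphism).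
   Formalization: The coproduct is ill-defined on differential operators for commuting variables, so ''Hopf homomorphism'' means that S_{F_t} is induced by a Hopf homomorphism from NSym to the enveloping algebra of Der^[α]<<z>>; membership in D^[α]<z> and grading are imposed on the operators. *)

(* Defs.v *)
From HB Require Import structures.
From mathcomp Require Import all_boot all_order all_algebra finmap.
From mathcomp Require Import boolp.
From mathcomp Require Import monalg.

Set Implicit Arguments.
Unset Strict Implicit.
Unset Printing Implicit Defensive.

Import GRing.Theory.
Local Open Scope ring_scope.

Inductive variable_kind := Commuting | Free.

Definition monomial (c : variable_kind) (n : nat) : monomType :=
  if c is Commuting then {cmonom 'I_n} else {fmonom 'I_n}.

Definition of_word {c n} : seq 'I_n -> monomial c n :=
  match c return seq 'I_n -> monomial c n with
  | Commuting => fun s => \big[@mmul {cmonom 'I_n}/mone]_(i <- s) ucm i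
  | Free => fun s => FMonom s
  end.

(* A word whose product is the given monomial; in the commuting case, the
   variables occur in it in increasing order. *)
Definition word {c n} : monomial c n -> seq 'I_n :=
  match c return monomial c n -> seq 'I_n with
  | Commuting => fun m => flatten [seq nseq (cmonom_val m i) i | i <- enum 'I_n]
  | Free => fun m => fmonom_val m
  end.

Definition deg {c n} (m : monomial c n) : nat := size (word m).

Section MonomialTheory.
Variables (c : variable_kind) (n : nat).
Implicit Types (m : monomial c n) (s : seq 'I_n).

Lemma of_word_nil : of_word [::] = mone :> monomial c n.
Proof.
case: c => /=; first by rewrite big_nil.
by rewrite /mone /one /= fmoneE.
Qed.

Lemma of_word_cat s t :
  of_word (s ++ t) = mmul (of_word s) (of_word t) :> monomial c n.
Proof.
case: c => /=; first by rewrite big_cat.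
by rewrite /mmul /mul /= fmmulE.
Qed.

Lemma of_word_commE s i :
  cmonom_val (of_word s : monomial Commuting n) i = count_mem i s.
Proof.
elim: s => [|j s IHs] /=; first by rewrite big_nil cm1.
by rewrite big_cons cmM cmU -IHs eq_sym.
Qed.

Lemma count_word_comm (m : monomial Commuting n) i :
  count_mem i (word m) = cmonom_val m i.
Proof.
rewrite /word count_flatten -map_comp sumnE big_map big_enum /=.
rewrite (bigD1 i) //= count_nseq /= eqxx mul1n big1 ?addn0 // => j nij.
by rewrite count_nseq /= (negbTE nij).
Qed.

Lemma wordK : cancel (@word c n) of_word.
Proof.
case: c => m; last by case: m.
by apply/eqP/cmP => i; rewrite of_word_commE count_word_comm.
Qed.

Lemma size_word_of_word s : size (word (of_word s : monomial c n)) = size s.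
Proof.
case: c => //; apply/perm_size/allP => i _ /=.
by rewrite count_word_comm of_word_commE.
Qed.

Lemma deg1 : deg (mone : monomial c n) = 0%N.
Proof. by rewrite /deg -of_word_nil size_word_of_word. Qed.

Lemma degM m m' : deg (mmul m m') = (deg m + deg m')%N.
Proof. by rewrite -{1}[m]wordK -{1}[m']wordK -of_word_cat /deg size_word_of_word size_cat. Qed.

Definition monomials (d : nat) : seq (monomial c n) :=
  undup (flatten [seq [seq of_word (tval w) | w <- enum {: k.-tuple 'I_n}]
                 | k <- iota 0 d.+1]).

Lemma monomials_uniq d : uniq (monomials d).
Proof. exact: undup_uniq. Qed.

Lemma mem_monomials d m : (m \in monomials d) = (deg m <= d)%N.
Proof.
rewrite mem_undup; apply/flatten_mapP/idP => [[k]|ld].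
  rewrite mem_iota /= => lk /mapP[w _ ->].
  by rewrite /deg size_word_of_word size_tuple.
exists (deg m); first by rewrite mem_iota.
by apply/mapP; exists (in_tuple (word m)); rewrite ?mem_enum //= wordK.
Qed.
End MonomialTheory.

Definition zmon {c n} (i : 'I_n) : monomial c n := of_word [:: i].

(* R<<z>>: a power series is the family of its coefficients.                 *)

Record series (c : variable_kind) (n : nat) (R : Type) :=
  Series { scoef :> monomial c n -> R }.

HB.instance Definition _ c n (R : Type) := [isNew for @scoef c n R].
HB.instance Definition _ c n (R : choiceType) := [Choice of series c n R by <:].

Lemma seriesP c n (R : Type) (u v : series c n R) : u =1 v -> u = v.
Proof. by case: u v => [u] [v] /funext/= ->. Qed.

Section SeriesRing.
Variables (c : variable_kind) (n : nat) (R : nzRingType).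
Implicit Types (u v w : series c n R) (m : monomial c n).

Definition series_add u v : series c n R := Series (fun m => u m + v m).
Definition series_opp u : series c n R := Series (fun m => - u m).
Definition series_mul u v : series c n R :=
  Series (fun m => \sum_(a <- monomials c n (deg m))
                   \sum_(b <- monomials c n (deg m) | mmul a b == m) u a * v b).

Fact series_addA : associative series_add.
Proof. by move=> u v w; apply: seriesP => m /=; rewrite addrA. Qed.
Fact series_addC : commutative series_add.
Proof. by move=> u v; apply: seriesP => m /=; rewrite addrC. Qed.
Fact series_add0 : left_id (Series (fun=> 0)) series_add.
Proof. by move=> u; apply: seriesP => m /=; rewrite add0r. Qed.
Fact series_addN : left_inverse (Series (fun=> 0)) series_opp series_add.
Proof. by move=> u; apply: seriesP => m /=; rewrite addNr. Qed.

HB.instance Definition _ := GRing.isZmodule.Build (series c n R)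
  series_addA series_addC series_add0 series_addN.

Lemma series_mulEw d u v m : (deg m <= d)%N -> series_mul u v m =
  \sum_(a <- monomials c n d) \sum_(b <- monomials c n d | mmul a b == m)
     u a * v b.
Proof.
move=> led /=.
have sub e (F : monomial c n -> R) : (deg m <= e)%N ->
    (forall a, (deg m < deg a)%N -> F a = 0) ->
    \sum_(a <- monomials c n e) F a = \sum_(a <- monomials c n (deg m)) F a.
  move=> lee F0; rewrite (bigID (fun a => deg a <= deg m)%N) /= addrC big1.
    rewrite add0r -big_filter; apply: perm_big; apply: uniq_perm.
    - exact/filter_uniq/monomials_uniq.
    - exact: monomials_uniq.
    - move=> a; rewrite mem_filter !mem_monomials.
      by apply/andb_idr => /leq_trans; apply.
  by move=> a; rewrite -ltnNge => /F0.
rewrite [RHS]sub //; last first.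
  move=> a lta; rewrite big_pred0 // => b; apply: contraTF lta => /eqP<-.
  by rewrite degM -leqNgt leq_addr.
apply: eq_bigr => a _; rewrite big_mkcond [RHS]big_mkcond /= [RHS]sub // => b ltb.
by case: eqP => // eqm; move: ltb; rewrite -eqm degM ltnNge leq_addl.
Qed.

Fact series_mulA : associative series_mul.
Proof.
move=> u v w; apply: seriesP => m; set d := deg m.
pose tri a b e := mmul a (mmul b e) == m.
transitivity (\sum_(a <- monomials c n d) \sum_(b <- monomials c n d)
   \sum_(e <- monomials c n d | tri a b e) u a * (v b * w e)).
  rewrite (series_mulEw (d := d)) //; apply: eq_bigr => a _.
  transitivity (\sum_(x <- monomials c n d | mmul a x == m)
      \sum_(b <- monomials c n d) \sum_(e <- monomials c n d | mmul b e == x)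
        u a * (v b * w e)).
    apply: eq_bigr => x /eqP eqm; rewrite (series_mulEw (d := d)); last first.
      by rewrite /d -eqm degM leq_addl.
    by rewrite mulr_sumr; apply: eq_bigr => b _; rewrite mulr_sumr.
  rewrite exchange_big; apply: eq_bigr => b _.
  rewrite (exchange_big_dep (tri a b)) /=; last first.
    by move=> x e eqm /eqP ex; rewrite /tri ex.
  rewrite big_seq_cond [RHS]big_seq_cond; apply: eq_bigr => e /andP[_ abe].
  rewrite (big_rem (mmul b e)) /=; last first.
    by rewrite mem_monomials /d -(eqP abe) [leqRHS]degM leq_addl.
  rewrite -/(tri a b e) abe eqxx /= big1_seq ?addr0 // => x /andP[/andP[_ /eqP<-]].
  by rewrite mem_rem_uniq ?monomials_uniq // !inE eqxx.
symmetry; rewrite (series_mulEw (d := d)) //.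
transitivity (\sum_(x <- monomials c n d) \sum_(e <- monomials c n d | mmul x e == m)
   \sum_(a <- monomials c n d) \sum_(b <- monomials c n d | mmul a b == x)
        u a * (v b * w e)).
  apply: eq_bigr => x _; apply: eq_bigr => e /eqP eqm.
  rewrite (series_mulEw (d := d)); last by rewrite /d -eqm degM leq_addr.
  rewrite mulr_suml; apply: eq_bigr => a _; rewrite mulr_suml.
  by apply: eq_bigr => b _; rewrite mulrA.
under eq_bigr => x _ do rewrite exchange_big.
rewrite exchange_big; apply: eq_bigr => a _.
under eq_bigr => x _ do rewrite exchange_big.
under eq_bigr => x _ do rewrite big_mkcond.
rewrite exchange_big; apply: eq_bigr => b _ /=.
case lab: (deg (mmul a b) <= d)%N.
  rewrite (big_rem (mmul a b)) /= ?mem_monomials // eqxx [X in _ + X]big1_seq; last first.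
    move=> x /andP[_]; rewrite mem_rem_uniq ?monomials_uniq // !inE.
    by rewrite eq_sym => /andP[/negbTE->].
  by rewrite addr0; apply: eq_bigl => e; rewrite /tri mulmA.
rewrite big1_seq; last first.
  move=> x /andP[_]; rewrite mem_monomials; case: eqP => // <-.
  by rewrite lab.
rewrite big_pred0 // => e; apply: contraFF lab => /eqP.
by rewrite mulmA /d => <-; rewrite [leqRHS]degM leq_addr.
Qed.

Fact series_mul1 : left_id (Series (fun m => (m == mone)%:R)) series_mul.
Proof.
move=> u; apply: seriesP => m /=.
rewrite (big_rem mone) ?mem_monomials ?deg1 //= eqxx.
rewrite (big_rem m) ?mem_monomials //= mul1m eqxx mul1r.
rewrite big1_seq ?addr0; last first.
  move=> b /andP[]; rewrite mul1m => /eqP->.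
  by rewrite mem_rem_uniq ?monomials_uniq // !inE eqxx.
rewrite big1_seq ?addr0 // => a /andP[_].
rewrite mem_rem_uniq ?monomials_uniq // !inE => /andP[/negbTE-> _].
by rewrite big1 // => b _; rewrite mul0r.
Qed.

Fact series_mulr1 : right_id (Series (fun m => (m == mone)%:R)) series_mul.
Proof.
move=> u; apply: seriesP => m /=.
rewrite (big_rem m) ?mem_monomials //=.
rewrite (big_rem mone) ?mem_monomials ?deg1 //= mulm1 !eqxx mulr1.
rewrite big1_seq ?addr0; last first.
  move=> b /andP[_]; rewrite mem_rem_uniq ?monomials_uniq // !inE.
  by move=> /andP[/negbTE->]; rewrite mulr0.
rewrite big1_seq ?addr0 // => a /andP[_].
rewrite mem_rem_uniq ?monomials_uniq // !inE => /andP[nam _].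
rewrite big1 // => b /eqP eqm; case: eqP => [eqb|]; last by rewrite mulr0.
by move: nam; rewrite -eqm eqb mulm1 eqxx.
Qed.

Fact series_mulDl : left_distributive series_mul +%R.
Proof.
move=> u v w; apply: seriesP => m /=; rewrite -big_split; apply: eq_bigr => a _ /=.
by rewrite -big_split; apply: eq_bigr => b _; rewrite mulrDl.
Qed.

Fact series_mulDr : right_distributive series_mul +%R.
Proof.
move=> u v w; apply: seriesP => m /=; rewrite -big_split; apply: eq_bigr => a _ /=.
by rewrite -big_split; apply: eq_bigr => b _; rewrite mulrDr.
Qed.

Fact series_1_neq0 : Series (fun m => (m == mone)%:R) != 0 :> series c n R.
Proof.
apply/eqP => /(congr1 (fun u : series c n R => u mone)) /eqP.
by rewrite /= eqxx oner_eq0.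
Qed.

HB.instance Definition _ := GRing.Zmodule_isNzRing.Build (series c n R)
  series_mulA series_mul1 series_mulr1 series_mulDl series_mulDr series_1_neq0.

Definition series_scale (k : R) u : series c n R := Series (fun m => k * u m).

Fact series_scaleA a b u : series_scale a (series_scale b u) = series_scale (a * b) u.
Proof. by apply: seriesP => m /=; rewrite mulrA. Qed.
Fact series_scale1 : left_id 1 series_scale.
Proof. by move=> u; apply: seriesP => m /=; rewrite mul1r. Qed.
Fact series_scaleDr : right_distributive series_scale +%R.
Proof. by move=> a u v; apply: seriesP => m /=; rewrite mulrDr. Qed.
Fact series_scaleDl u : {morph series_scale^~ u : a b / a + b}.
Proof. by move=> a b; apply: seriesP => m /=; rewrite mulrDl. Qed.

HB.instance Definition _ := GRing.Zmodule_isLmodule.Build R (series c n R)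
  series_scaleA series_scale1 series_scaleDr series_scaleDl.

Fact series_scaleAl (k : R) u v : k *: (u * v) = k *: u * v.
Proof.
apply: seriesP => m /=; rewrite mulr_sumr; apply: eq_bigr => a _.
by rewrite mulr_sumr; apply: eq_bigr => b _; rewrite mulrA.
Qed.

HB.instance Definition _ := GRing.Lmodule_isLalgebra.Build R (series c n R)
  series_scaleAl.
End SeriesRing.

Section SeriesAlgebra.
Variables (c : variable_kind) (n : nat) (K : comNzRingType).

Fact series_scaleAr (k : K) (u v : series c n K) : k *: (u * v) = u * (k *: v).
Proof.
apply: seriesP => m /=; rewrite mulr_sumr; apply: eq_bigr => a _.
by rewrite mulr_sumr; apply: eq_bigr => b _; rewrite mulrCA.
Qed.

HB.instance Definition _ := GRing.Lalgebra_isAlgebra.Build K (series c n K)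
  series_scaleAr.
End SeriesAlgebra.

(* {malg K[M]} is only known to the library as an algebra for commutative M;  *)
(* this alias is an algebra over a commutative K for every M.                 *)

Definition monoid_algebra (K : comNzRingType) (M : monomType) : Type :=
  {malg K[M]}.

Section MonoidAlgebra.
Variables (K : comNzRingType) (M : monomType).

HB.instance Definition _ := GRing.Lalgebra.copy (monoid_algebra K M) {malg K[M]}.

Fact monoid_algebra_scaleAr (k : K) (x y : monoid_algebra K M) :
  k *: (x * y) = x * (k *: y).
Proof.
have kC (z : {malg K[M]}) : k%:MP * z = z * k%:MP.
  rewrite !malgM_def fgmulUg fgmulgU; apply: eq_bigr => m _.
  by rewrite mulrC mul1m mulm1.
suff: k *: ((x : {malg K[M]}) * y) = (x : {malg K[M]}) * (k *: (y : {malg K[M]})) by [].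
by rewrite -!mul_malgC mulrA kC -mulrA.
Qed.

HB.instance Definition _ :=
  GRing.Lalgebra_isAlgebra.Build K (monoid_algebra K M) monoid_algebra_scaleAr.
End MonoidAlgebra.

(* K<z>, with z commuting or free. *)
Definition zpoly (c : variable_kind) (n : nat) (K : comNzRingType) : algType K :=
  monoid_algebra K (monomial c n).

(* The free associative K-algebra on a set T of generators. *)
Definition free_algebra (K : comNzRingType) (T : choiceType) : algType K :=
  monoid_algebra K {fmonom T}.

Section FreeAlgebra.
Variables (K : comNzRingType) (T : choiceType).

Definition free_gen (x : T) : free_algebra K T := << fmu x >>.

(* The value at f : T -> B of a noncommutative polynomial. *)
Definition free_lift (B : algType K) (f : T -> B) (p : free_algebra K T) : B :=
  \sum_(w <- msupp p) p@_w *: \prod_(x <- fmonom_val w) f x.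

Variables (B : algType K) (f : T -> B).

Let h (w : {fmonom T}) : B := \prod_(x <- fmonom_val w) f x.

Fact free_lift_mmorphism : mmorphism h.
Proof.
split=> [v w|]; first by rewrite /h fmM big_cat.
by rewrite /h fm1 big_nil.
Qed.
HB.instance Definition _ := isMultiplicative.Build _ _ h free_lift_mmorphism.

Lemma free_liftE : free_lift f =1 mmap (GRing.in_alg B) h.
Proof. by move=> p; apply: eq_bigr => w _; rewrite mulr_algl. Qed.

Fact free_lift_semilinear : linear (free_lift f).
Proof.
by move=> k p q; rewrite !free_liftE mmapD mmapZ mulr_algl.
Qed.
HB.instance Definition _ :=
  GRing.isLinear.Build K (free_algebra K T) B *:%R (free_lift f) free_lift_semilinear.

Fact free_lift_monoid_morphism : monoid_morphism (free_lift f).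
Proof.
have [hM h1] : multiplicative (mmap (GRing.in_alg B) h).
  by apply: commr_mmap_is_multiplicative => g m m'; rewrite /GRing.comm mulr_algl mulr_algr.
by split=> [|p q]; rewrite !free_liftE.
Qed.
HB.instance Definition _ :=
  GRing.isMonoidMorphism.Build (free_algebra K T) B (free_lift f)
    free_lift_monoid_morphism.

Lemma free_lift_gen x : free_lift f (free_gen x) = f x.
Proof. by rewrite free_liftE mmapU /= scale1r mul1r /h fmU big_seq1. Qed.
End FreeAlgebra.

Record endo (K : comNzRingType) (A : algType K) :=
  Endo { endo_fun :> A -> A; endoP : linear endo_fun }.

HB.instance Definition _ K A := gen_eqMixin (@endo K A).
HB.instance Definition _ K A := gen_choiceMixin (@endo K A).

Section Endo.
Variables (K : comNzRingType) (A : algType K).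
Implicit Types (f g h : endo A).

HB.instance Definition _ f :=
  GRing.isLinear.Build K A A *:%R (endo_fun f) (endoP f).

Lemma endo_eqP f g : f =1 g -> f = g.
Proof.
case: f g => [f fP] [g gP] /= /funext fg; move: fP gP; rewrite fg => fP gP.
by rewrite (Prop_irrelevance fP gP).
Qed.

Fact endo0P : linear (fun _ : A => 0 : A).
Proof. by move=> k x y; rewrite scaler0 addr0. Qed.
Fact endo1P : linear (fun x : A => x).
Proof. by []. Qed.
Fact endoDP f g : linear (fun x => f x + g x).
Proof. by move=> k x y; rewrite !linearP scalerDr addrACA. Qed.
Fact endoNP f : linear (fun x => - f x).
Proof. by move=> k x y; rewrite linearP opprD scalerN. Qed.
Fact endoMP f g : linear (fun x => f (g x)).
Proof. by move=> k x y; rewrite !linearP. Qed.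
Fact endoZP (k : K) f : linear (fun x => k *: f x).
Proof. by move=> l x y; rewrite linearP scalerDr !scalerA mulrC. Qed.

Definition endo_add f g := Endo (endoDP f g).
Definition endo_opp f := Endo (endoNP f).
Definition endo_mul f g := Endo (endoMP f g).
Definition endo_scale k f := Endo (endoZP k f).

Fact endo_addA : associative endo_add.
Proof. by move=> f g h; apply: endo_eqP => x /=; rewrite addrA. Qed.
Fact endo_addC : commutative endo_add.
Proof. by move=> f g; apply: endo_eqP => x /=; rewrite addrC. Qed.
Fact endo_add0 : left_id (Endo endo0P) endo_add.
Proof. by move=> f; apply: endo_eqP => x /=; rewrite add0r. Qed.
Fact endo_addN : left_inverse (Endo endo0P) endo_opp endo_add.
Proof. by move=> f; apply: endo_eqP => x /=; rewrite addNr. Qed.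
HB.instance Definition _ := GRing.isZmodule.Build (endo A)
  endo_addA endo_addC endo_add0 endo_addN.

Fact endo_mulA : associative endo_mul.
Proof. by move=> f g h; apply: endo_eqP. Qed.
Fact endo_mul1 : left_id (Endo endo1P) endo_mul.
Proof. by move=> f; apply: endo_eqP. Qed.
Fact endo_mulr1 : right_id (Endo endo1P) endo_mul.
Proof. by move=> f; apply: endo_eqP. Qed.
Fact endo_mulDl : left_distributive endo_mul +%R.
Proof. by move=> f g h; apply: endo_eqP. Qed.
Fact endo_mulDr : right_distributive endo_mul +%R.
Proof. by move=> f g h; apply: endo_eqP => x /=; rewrite linearD. Qed.
Fact endo_1_neq0 : Endo endo1P != 0.
Proof.
apply/eqP => /(congr1 (fun f : endo A => f 1)) /= /eqP.
by rewrite oner_eq0.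
Qed.
HB.instance Definition _ := GRing.Zmodule_isNzRing.Build (endo A)
  endo_mulA endo_mul1 endo_mulr1 endo_mulDl endo_mulDr endo_1_neq0.

Fact endo_scaleA k l f : endo_scale k (endo_scale l f) = endo_scale (k * l) f.
Proof. by apply: endo_eqP => x /=; rewrite scalerA. Qed.
Fact endo_scale1 : left_id 1 endo_scale.
Proof. by move=> f; apply: endo_eqP => x /=; rewrite scale1r. Qed.
Fact endo_scaleDr : right_distributive endo_scale +%R.
Proof. by move=> k f g; apply: endo_eqP => x /=; rewrite scalerDr. Qed.
Fact endo_scaleDl f : {morph endo_scale^~ f : k l / k + l}.
Proof. by move=> k l; apply: endo_eqP => x /=; rewrite scalerDl. Qed.
HB.instance Definition _ := GRing.Zmodule_isLmodule.Build K (endo A)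
  endo_scaleA endo_scale1 endo_scaleDr endo_scaleDl.

Fact endo_scaleAl k f g : k *: (f * g) = k *: f * g.
Proof. exact: endo_eqP. Qed.
HB.instance Definition _ := GRing.Lmodule_isLalgebra.Build K (endo A) endo_scaleAl.

Fact endo_scaleAr k f g : k *: (f * g) = f * (k *: g).
Proof. by apply: endo_eqP => x /=; rewrite linearZ. Qed.
HB.instance Definition _ := GRing.Lalgebra_isAlgebra.Build K (endo A) endo_scaleAr.
End Endo.

Inductive generated_subalgebra (K : comNzRingType) (A : algType K) (X : A -> Prop) :
  A -> Prop :=
| GenSubalg1 : generated_subalgebra X 1
| GenSubalgX x of X x : generated_subalgebra X x
| GenSubalgZ k x of generated_subalgebra X x : generated_subalgebra X (k *: x)
| GenSubalgD x y of generated_subalgebra X x & generated_subalgebra X y :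
    generated_subalgebra X (x + y)
| GenSubalgM x y of generated_subalgebra X x & generated_subalgebra X y :
    generated_subalgebra X (x * y).

Definition derivation (K : comNzRingType) (A : algType K) (d : endo A) : Prop :=
  forall u v, d (u * v) = d u * v + u * d v.

(* The universal enveloping algebra of a Lie subalgebra L of an associative  *)
(* algebra A: the free algebra on the elements of L modulo the two-sided     *)
(* ideal generated by the linear relations and the bracket relations of L.   *)

Section Enveloping.
Variables (K : comNzRingType) (A : algType K) (L : A -> Prop).

Definition lie_elt : Type := {classic {x : A | L x}}.
HB.instance Definition _ := Choice.on lie_elt.

Definition lie_val (x : lie_elt) : A := sval (x : {x : A | L x}).

Local Notation "[ 'g' x ]" := (free_gen K (x : lie_elt)).

Inductive uea_ideal : free_algebra K lie_elt -> Prop :=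
| UeaLin k (x y z : lie_elt) of lie_val z = k *: lie_val x + lie_val y :
    uea_ideal ([g z] - (k *: [g x] + [g y]))
| UeaBracket (x y z : lie_elt) of
    lie_val z = lie_val x * lie_val y - lie_val y * lie_val x :
    uea_ideal ([g z] - ([g x] * [g y] - [g y] * [g x]))
| Uea0 : uea_ideal 0
| UeaD p q of uea_ideal p & uea_ideal q : uea_ideal (p + q)
| UeaM p q r of uea_ideal q : uea_ideal (p * q * r).

Lemma uea_idealZ k p : uea_ideal p -> uea_ideal (k *: p).
Proof. by move=> /(UeaM (k%:A) 1); rewrite mulr1 mulr_algl. Qed.

Lemma uea_idealN p : uea_ideal p -> uea_ideal (- p).
Proof. by rewrite -scaleN1r; apply: uea_idealZ. Qed.

Definition uea_equiv (p q : free_algebra K lie_elt) : bool := `[< uea_ideal (p - q) >].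

Fact uea_equiv_refl : reflexive uea_equiv.
Proof. by move=> p; apply/asboolP; rewrite subrr; exact: Uea0. Qed.
Fact uea_equiv_sym : symmetric uea_equiv.
Proof. by move=> p q; apply/asboolP/asboolP => /uea_idealN; rewrite opprB. Qed.
Fact uea_equiv_trans : transitive uea_equiv.
Proof.
move=> q p r /asboolP pq /asboolP qr; apply/asboolP.
by rewrite -(subrK q p) -addrA; exact: UeaD.
Qed.
Canonical uea_equivRel :=
  EquivRel uea_equiv uea_equiv_refl uea_equiv_sym uea_equiv_trans.

Definition uea : Type := {eq_quot uea_equiv}%qT.
HB.instance Definition _ := Choice.on uea.
HB.instance Definition _ := EqQuotient.on uea.

Local Notation pi := (\pi_uea)%qT.

Lemma uea_piP p q : uea_ideal (p - q) <-> pi p = pi q.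
Proof.
split=> [pq|/eqP]; first by apply/eqP; rewrite eqquotE; apply/asboolP.
by rewrite eqquotE => /asboolP.
Qed.

Lemma uea_repr p : uea_ideal (p - repr (pi p)).
Proof. by apply/uea_piP; rewrite reprK. Qed.

Definition uea_add (x y : uea) : uea := pi (repr x + repr y).
Definition uea_opp (x : uea) : uea := pi (- repr x).
Definition uea_mul (x y : uea) : uea := pi (repr x * repr y).
Definition uea_scale (k : K) (x : uea) : uea := pi (k *: repr x).

Lemma uea_piD p q : pi (p + q) = uea_add (pi p) (pi q).
Proof.
by apply/uea_piP; rewrite opprD addrACA; apply: UeaD; exact: uea_repr.
Qed.
Lemma uea_piN p : pi (- p) = uea_opp (pi p).
Proof. by apply/uea_piP; rewrite -opprD; apply/uea_idealN/uea_repr. Qed.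
Lemma uea_piZ k p : pi (k *: p) = uea_scale k (pi p).
Proof. by apply/uea_piP; rewrite -scalerBr; apply/uea_idealZ/uea_repr. Qed.
Lemma uea_piM p q : pi (p * q) = uea_mul (pi p) (pi q).
Proof.
apply/uea_piP; rewrite -(subrK (repr (pi p) * q) (p * q)) -addrA -mulrBl -mulrBr.
apply: UeaD; first by rewrite -[X in X * q]mul1r; apply/UeaM/uea_repr.
by rewrite -[X in uea_ideal X]mulr1; apply/UeaM/uea_repr.
Qed.

Lemma uea_ind (P : uea -> Prop) : (forall p, P (pi p)) -> forall x, P x.
Proof. by move=> Ppi x; rewrite -[x]reprK. Qed.

Fact uea_addA : associative uea_add.
Proof. by do 3![elim/uea_ind => ?]; rewrite -!uea_piD addrA. Qed.
Fact uea_addC : commutative uea_add.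
Proof. by do 2![elim/uea_ind => ?]; rewrite -!uea_piD addrC. Qed.
Fact uea_add0 : left_id (pi 0) uea_add.
Proof. by elim/uea_ind => ?; rewrite -!uea_piD add0r. Qed.
Fact uea_addN : left_inverse (pi 0) uea_opp uea_add.
Proof. by elim/uea_ind => ?; rewrite -uea_piN -!uea_piD addNr. Qed.
HB.instance Definition _ := GRing.isZmodule.Build uea
  uea_addA uea_addC uea_add0 uea_addN.

Fact uea_mulA : associative uea_mul.
Proof. by do 3![elim/uea_ind => ?]; rewrite -!uea_piM mulrA. Qed.
Fact uea_mul1 : left_id (pi 1) uea_mul.
Proof. by elim/uea_ind => ?; rewrite -uea_piM mul1r. Qed.
Fact uea_mulr1 : right_id (pi 1) uea_mul.
Proof. by elim/uea_ind => ?; rewrite -uea_piM mulr1. Qed.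
Fact uea_mulDl : left_distributive uea_mul uea_add.
Proof.
by do 3![elim/uea_ind => ?]; rewrite -!(uea_piM, uea_piD) mulrDl.
Qed.
Fact uea_mulDr : right_distributive uea_mul uea_add.
Proof.
by do 3![elim/uea_ind => ?]; rewrite -!(uea_piM, uea_piD) mulrDr.
Qed.

Lemma uea_ideal_lift (B : algType K) (f : lie_elt -> B) :
  (forall k x y z, lie_val z = k *: lie_val x + lie_val y ->
     f z = k *: f x + f y) ->
  (forall x y z, lie_val z = lie_val x * lie_val y - lie_val y * lie_val x ->
     f z = f x * f y - f y * f x) ->
  forall p, uea_ideal p -> free_lift f p = 0.
Proof.
move=> flin fbr p; elim=> {p} [k x y z e|x y z e||p q _ p0 _ q0|p q r _ q0].
- by rewrite linearB linearP /= !free_lift_gen (flin _ _ _ _ e) subrr.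
- by rewrite linearB linearB !rmorphM /= !free_lift_gen (fbr _ _ _ e) subrr.
- exact: raddf0.
- by rewrite linearD /= p0 q0 addr0.
- by rewrite !rmorphM /= q0 mulr0 mul0r.
Qed.

Fact uea_1_neq0 : pi 1 != pi 0.
Proof.
apply/eqP => /uea_piP; rewrite subr0.
move=> /(@uea_ideal_lift K^o (fun=> 0)); rewrite rmorph1 => h.
suff /eqP : (1 : K) = 0 by rewrite oner_eq0.
by apply: h => *; rewrite ?scaler0 ?mul0r ?subrr ?addr0.
Qed.
HB.instance Definition _ := GRing.Zmodule_isNzRing.Build uea
  uea_mulA uea_mul1 uea_mulr1 uea_mulDl uea_mulDr uea_1_neq0.

Fact uea_scaleA k l x : uea_scale k (uea_scale l x) = uea_scale (k * l) x.
Proof. by elim/uea_ind: x => ?; rewrite -!uea_piZ scalerA. Qed.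
Fact uea_scale1 : left_id 1 uea_scale.
Proof. by elim/uea_ind => ?; rewrite -!uea_piZ scale1r. Qed.
Fact uea_scaleDr : right_distributive uea_scale uea_add.
Proof. by move=> k; do 2![elim/uea_ind => ?]; rewrite -!(uea_piZ, uea_piD) scalerDr. Qed.
Fact uea_scaleDl x : {morph uea_scale^~ x : k l / k + l >-> uea_add k l}.
Proof. by move=> k l; elim/uea_ind: x => ?; rewrite -!(uea_piZ, uea_piD) scalerDl. Qed.
HB.instance Definition _ := GRing.Zmodule_isLmodule.Build K uea
  uea_scaleA uea_scale1 uea_scaleDr uea_scaleDl.

Fact uea_scaleAl (k : K) (x y : uea) : k *: (x * y) = k *: x * y.
Proof.
elim/uea_ind: x => p; elim/uea_ind: y => q.
suff: uea_scale k (uea_mul (pi p) (pi q)) = uea_mul (uea_scale k (pi p)) (pi q) by [].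
by rewrite -!(uea_piZ, uea_piM) scalerAl.
Qed.
HB.instance Definition _ := GRing.Lmodule_isLalgebra.Build K uea uea_scaleAl.

Fact uea_scaleAr (k : K) (x y : uea) : k *: (x * y) = x * (k *: y).
Proof.
elim/uea_ind: x => p; elim/uea_ind: y => q.
suff: uea_scale k (uea_mul (pi p) (pi q)) = uea_mul (pi p) (uea_scale k (pi q)) by [].
by rewrite -!(uea_piZ, uea_piM) scalerAr.
Qed.
HB.instance Definition _ := GRing.Lalgebra_isAlgebra.Build K uea uea_scaleAr.

Definition uea_gen (x : lie_elt) : uea := pi [g x].

(* The canonical map U(L) -> A extending the inclusion of L. *)
Definition uea_act (u : uea) : A := free_lift lie_val (repr u).

Lemma uea_act_pi p : uea_act (pi p) = free_lift lie_val p.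
Proof.
apply/eqP; rewrite eq_sym -subr_eq0 -linearB; apply/eqP.
by apply: uea_ideal_lift (uea_repr p) => [*|*].
Qed.
End Enveloping.

(* The tensor product U (x) V of two K-modules: formal sums of pure tensors,  *)
(* two sums being equal when every K-bilinear map gives them the same value.  *)

Definition bilinear_map (K : comNzRingType) (U V W : lmodType K) (b : U -> V -> W) :=
  (forall y, linear (b^~ y)) /\ (forall x, linear (b x)).

Section Tensor.
Variables (K : comNzRingType) (U V : lmodType K).

Definition tensor_eval (W : lmodType K) (b : U -> V -> W) (s : seq (U * V)) : W :=
  \sum_(p <- s) b p.1 p.2.

Definition tensor_equiv (s s' : seq (U * V)) : bool :=
  `[< forall (W : lmodType K) (b : U -> V -> W), bilinear_map b ->
      tensor_eval b s = tensor_eval b s' >].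

Fact tensor_equiv_refl : reflexive tensor_equiv.
Proof. by move=> s; apply/asboolP. Qed.
Fact tensor_equiv_sym : symmetric tensor_equiv.
Proof. by move=> s s'; apply/asboolP/asboolP => e W b /e. Qed.
Fact tensor_equiv_trans : transitive tensor_equiv.
Proof.
move=> s' s s'' /asboolP e /asboolP e'; apply/asboolP => W b bb.
by rewrite e ?e'.
Qed.
Canonical tensor_equivRel :=
  EquivRel tensor_equiv tensor_equiv_refl tensor_equiv_sym tensor_equiv_trans.

Definition tensor : Type := {eq_quot tensor_equiv}%qT.
HB.instance Definition _ := Choice.on tensor.
HB.instance Definition _ := EqQuotient.on tensor.

Local Notation pi := (\pi_tensor)%qT.

Definition pure_tensor (x : U) (y : V) : tensor := pi [:: (x, y)].

Definition tensor_add (s t : tensor) : tensor := pi (repr s ++ repr t).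
Definition tensor_scale (k : K) (s : tensor) : tensor :=
  pi [seq (k *: p.1, p.2) | p <- repr s].
Definition tensor_opp (s : tensor) : tensor := tensor_scale (-1) s.

(* The linear map U (x) V -> W induced by a bilinear map b. *)
Definition tensor_lift (W : lmodType K) (b : U -> V -> W) (s : tensor) : W :=
  tensor_eval b (repr s).

Lemma tensor_piP s s' :
  (forall (W : lmodType K) (b : U -> V -> W), bilinear_map b ->
     tensor_eval b s = tensor_eval b s') <-> pi s = pi s'.
Proof.
split=> [e|/eqP]; first by apply/eqP; rewrite eqquotE; apply/asboolP.
by rewrite eqquotE => /asboolP.
Qed.

Section Lift.
Variables (W : lmodType K) (b : U -> V -> W) (bb : bilinear_map b).

Lemma tensor_lift_pi s : tensor_lift b (pi s) = tensor_eval b s.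
Proof. by move/tensor_piP: (reprK (pi s)); apply. Qed.

Lemma tensor_eval_cat s s' :
  tensor_eval b (s ++ s') = tensor_eval b s + tensor_eval b s'.
Proof. exact: big_cat. Qed.

Lemma tensor_eval_scale k s :
  tensor_eval b [seq (k *: p.1, p.2) | p <- s] = k *: tensor_eval b s.
Proof.
rewrite /tensor_eval big_map scaler_sumr; apply: eq_bigr => p _ /=.
by have := bb.1 p.2 k p.1 0; rewrite addr0 => ->; have := bb.1 p.2 (-1) 0 0;
   rewrite scaler0 addr0 scaleN1r addNr => ->; rewrite addr0.
Qed.

Lemma tensor_liftD s t :
  tensor_lift b (tensor_add s t) = tensor_lift b s + tensor_lift b t.
Proof. by rewrite tensor_lift_pi tensor_eval_cat. Qed.

Lemma tensor_liftZ k s : tensor_lift b (tensor_scale k s) = k *: tensor_lift b s.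
Proof. by rewrite tensor_lift_pi tensor_eval_scale. Qed.

Lemma tensor_lift_pure x y : tensor_lift b (pure_tensor x y) = b x y.
Proof. by rewrite tensor_lift_pi /tensor_eval big_seq1. Qed.
End Lift.

Lemma tensor_eq (s t : tensor) :
  (forall (W : lmodType K) (b : U -> V -> W), bilinear_map b ->
     tensor_lift b s = tensor_lift b t) -> s = t.
Proof. by move=> e; rewrite -[s]reprK -[t]reprK; apply/tensor_piP. Qed.

Lemma tensor_lift0 (W : lmodType K) (b : U -> V -> W) :
  bilinear_map b -> tensor_lift b (pi [::]) = 0.
Proof. by move=> bb; rewrite tensor_lift_pi // /tensor_eval big_nil. Qed.

Fact tensor_addA : associative tensor_add.
Proof. by move=> s t u; apply: tensor_eq => W b bb; rewrite !tensor_liftD ?addrA. Qed.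
Fact tensor_addC : commutative tensor_add.
Proof. by move=> s t; apply: tensor_eq => W b bb; rewrite !tensor_liftD 1?addrC. Qed.
Fact tensor_add0 : left_id (pi [::]) tensor_add.
Proof.
by move=> s; apply: tensor_eq => W b bb; rewrite !tensor_liftD ?tensor_lift0 ?add0r.
Qed.
Fact tensor_addN : left_inverse (pi [::]) tensor_opp tensor_add.
Proof.
move=> s; apply: tensor_eq => W b bb.
by rewrite !tensor_liftD ?tensor_liftZ ?tensor_lift0 ?scaleN1r ?addNr.
Qed.
HB.instance Definition _ := GRing.isZmodule.Build tensor
  tensor_addA tensor_addC tensor_add0 tensor_addN.

Fact tensor_scaleA k l s : tensor_scale k (tensor_scale l s) = tensor_scale (k * l) s.
Proof. by apply: tensor_eq => W b bb; rewrite !tensor_liftZ ?scalerA. Qed.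
Fact tensor_scale1 : left_id 1 tensor_scale.
Proof. by move=> s; apply: tensor_eq => W b bb; rewrite !tensor_liftZ ?scale1r. Qed.
Fact tensor_scaleDr : right_distributive tensor_scale tensor_add.
Proof.
move=> k s t; apply: tensor_eq => W b bb.
by rewrite !(tensor_liftZ, tensor_liftD) ?scalerDr.
Qed.
Fact tensor_scaleDl s :
  {morph tensor_scale^~ s : k l / k + l >-> tensor_add k l}.
Proof.
move=> k l; apply: tensor_eq => W b bb.
by rewrite !(tensor_liftZ, tensor_liftD) ?scalerDl.
Qed.
HB.instance Definition _ := GRing.Zmodule_isLmodule.Build K tensor
  tensor_scaleA tensor_scale1 tensor_scaleDr tensor_scaleDl.

Lemma tensor_lift_linear (W : lmodType K) (b : U -> V -> W) :
  bilinear_map b -> linear (tensor_lift b).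
Proof.
by move=> bb k s t; rewrite [LHS]tensor_liftD // [in LHS]tensor_liftZ.
Qed.

Lemma pure_tensor_bilinear : bilinear_map pure_tensor.
Proof.
split=> [y k x x'|x k y y']; apply: tensor_eq => W b bb;
  by rewrite [RHS]tensor_liftD // [in RHS]tensor_liftZ // !tensor_lift_pure //
     ?(bb.1 y) ?(bb.2 x).
Qed.

Lemma tensor_pureE (s : tensor) : s = \sum_(p <- repr s) pure_tensor p.1 p.2.
Proof.
apply: tensor_eq => W b bb.
have -> : \sum_(p <- repr s) pure_tensor p.1 p.2 = pi (repr s).
  elim: (repr s) => [|p r IHr]; first by rewrite big_nil.
  rewrite big_cons IHr; apply: tensor_eq => X b' bb'.
  rewrite [LHS]tensor_liftD // tensor_lift_pure // !tensor_lift_pi //.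
  by rewrite /tensor_eval big_cons.
by rewrite reprK.
Qed.
End Tensor.

Notation "x ⊗ y" := (pure_tensor x y) (at level 40, left associativity).

Definition tensor_map (K : comNzRingType) (U V U' V' : lmodType K)
    (f : U -> U') (g : V -> V') : tensor U V -> tensor U' V' :=
  tensor_lift (fun x y => f x ⊗ g y).

Definition tensor_assoc (K : comNzRingType) (U V W : lmodType K) :
    tensor (tensor U V) W -> tensor U (tensor V W) :=
  tensor_lift (fun s z => tensor_lift (fun x y => x ⊗ (y ⊗ z)) s).

Section TensorAlgebra.
Variables (K : comNzRingType) (A B : algType K).

Definition tensor_mul (s t : tensor A B) : tensor A B :=
  tensor_lift (fun x y => tensor_lift (fun x' y' => (x * x') ⊗ (y * y')) t) s.

Let bil_inner x y : bilinear_map (fun x' y' => (x * x') ⊗ (y * y') : tensor A B).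
Proof.
split=> [y' k u v|x' k u v]; rewrite mulrDr -scalerAr.
  exact: (pure_tensor_bilinear A B).1.
exact: (pure_tensor_bilinear A B).2.
Qed.

Let bil_outer (t : tensor A B) : bilinear_map (fun x y =>
  tensor_lift (fun x' y' => (x * x') ⊗ (y * y') : tensor A B) t).
Proof.
split=> [y k u v|x k u v]; rewrite /tensor_lift /tensor_eval scaler_sumr -big_split;
  apply: eq_bigr => p _ /=; rewrite mulrDl -scalerAl.
  exact: (pure_tensor_bilinear A B).1.
exact: (pure_tensor_bilinear A B).2.
Qed.

Lemma tensor_mul_pure x y x' y' :
  tensor_mul (x ⊗ y) (x' ⊗ y') = (x * x') ⊗ (y * y').
Proof.
by rewrite /tensor_mul tensor_lift_pure ?tensor_lift_pure; [|exact: bil_inner|exact: bil_outer].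
Qed.

Fact tensor_mulDl : left_distributive tensor_mul +%R.
Proof. by move=> s t u; exact/tensor_liftD/bil_outer. Qed.

Fact tensor_mulDr : right_distributive tensor_mul +%R.
Proof.
move=> s t u; rewrite /tensor_mul /tensor_lift -/(tensor_lift _ _) /tensor_eval.
rewrite -big_split; apply: eq_bigr => p _ /=.
exact/(tensor_liftD (bil_inner _ _)).
Qed.

Lemma tensor_mul_suml (I : Type) (r : seq I) (F : I -> tensor A B) t :
  tensor_mul (\sum_(i <- r) F i) t = \sum_(i <- r) tensor_mul (F i) t.
Proof.
apply: (big_morph (tensor_mul^~ t)) => [s s'|]; first exact: tensor_mulDl.
by apply: (addrI (tensor_mul 0 t)); rewrite -tensor_mulDl !addr0.
Qed.

Lemma tensor_mul_sumr (I : Type) (r : seq I) (F : I -> tensor A B) t :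
  tensor_mul t (\sum_(i <- r) F i) = \sum_(i <- r) tensor_mul t (F i).
Proof.
apply: (big_morph (tensor_mul t)) => [s s'|]; first exact: tensor_mulDr.
by apply: (addrI (tensor_mul t 0)); rewrite -tensor_mulDr !addr0.
Qed.

Fact tensor_mulA : associative tensor_mul.
Proof.
move=> s t u; rewrite [s]tensor_pureE [t]tensor_pureE [u]tensor_pureE.
rewrite !tensor_mul_suml; apply: eq_bigr => p _.
rewrite tensor_mul_sumr [X in _ = tensor_mul X _]tensor_mul_sumr tensor_mul_suml.
apply: eq_bigr => q _.
rewrite !tensor_mul_sumr; apply: eq_bigr => r _.
by rewrite !tensor_mul_pure !mulrA.
Qed.

Fact tensor_mul1 : left_id (1 ⊗ 1) tensor_mul.
Proof.
move=> s; rewrite [s]tensor_pureE tensor_mul_sumr; apply: eq_bigr => p _.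
by rewrite tensor_mul_pure !mul1r.
Qed.

Fact tensor_mulr1 : right_id (1 ⊗ 1) tensor_mul.
Proof.
move=> s; rewrite [s]tensor_pureE tensor_mul_suml; apply: eq_bigr => p _.
by rewrite tensor_mul_pure !mulr1.
Qed.

(* A (x) B can be the zero ring, so it is not given the structure of an       *)
(* algType.                                                                   *)
HB.instance Definition _ := GRing.Zmodule_isPzRing.Build (tensor A B)
  tensor_mulA tensor_mul1 tensor_mulr1 tensor_mulDl tensor_mulDr.
End TensorAlgebra.

Record hopf_algebra (K : comNzRingType) (H : algType K) := HopfAlgebra {
  comul : {lrmorphism H -> tensor H H | *:%R};
  counit : {lrmorphism H -> K | *%R};
  antipode : {linear H -> H};
  hopf_coassoc : forall x,
    tensor_assoc (tensor_map comul idfun (comul x)) =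
    tensor_map idfun comul (comul x);
  hopf_counitl : forall x, tensor_lift (fun y z => counit y *: z) (comul x) = x;
  hopf_counitr : forall x, tensor_lift (fun y z => counit z *: y) (comul x) = x;
  hopf_antipodel : forall x,
    tensor_lift (fun y z => antipode y * z) (comul x) = (counit x)%:A;
  hopf_antipoder : forall x,
    tensor_lift (fun y z => y * antipode z) (comul x) = (counit x)%:A
}.

Definition primitive_elt (K : comNzRingType) (H : algType K)
    (h : hopf_algebra H) (x : H) : Prop :=
  [/\ comul h x = 1 ⊗ x + x ⊗ 1, counit h x = 0 & antipode h x = - x].

Definition hopf_morphism (K : comNzRingType) (H H' : algType K)
    (h : hopf_algebra H) (h' : hopf_algebra H') (f : {lrmorphism H -> H'}) : Prop :=
  [/\ forall x, comul h' (f x) = tensor_map f f (comul h x),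
      forall x, counit h' (f x) = counit h x
    & forall x, antipode h' (f x) = f (antipode h x)].

(* R[[t]] is the algebra of power series in one variable. It is also used    *)
(* over a noncommutative R; t always commutes with the coefficients.         *)

Definition tseries (R : Type) : Type := series Commuting 1 R.
HB.instance Definition _ (R : nzRingType) := GRing.Lalgebra.on (tseries R).
HB.instance Definition _ (K : comNzRingType) := GRing.Algebra.on (tseries K).

(* The series sum_k t^k a_k, and the coefficient of t^k in a series. *)
Definition tseries_of {R : Type} (a : nat -> R) : tseries R :=
  Series (fun m => a (deg m)).
Definition tcoef {R : Type} (a : tseries R) (k : nat) : R :=
  scoef a (of_word (nseq k ord0)).

Definition tmonomial {R : nzRingType} (a : R) (k : nat) : tseries R :=
  tseries_of (fun j => if j == k then a else 0).

Section Substitution.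
Variables (c : variable_kind) (n : nat) (R : nzRingType).

Definition zvar (i : 'I_n) : series c n R := Series (fun m => (m == zmon i)%:R).

Definition order_ge (alpha : nat) (u : series c n R) : Prop :=
  forall m, (deg m < alpha)%N -> u m = 0.

(* u(F(z)), for F with o(F) >= 1: a monomial w of degree greater than deg m  *)
(* does not contribute to the coefficient of m.                              *)
Definition substitute (F : 'I_n -> series c n R) (u : series c n R) : series c n R :=
  Series (fun m => \sum_(w <- monomials c n (deg m))
                     u w * (\prod_(i <- word w) F i) m).

(* F defines an automorphism u(z) |-> u(F(z)) of R<<z>> over R. *)
Definition automorphism (F : 'I_n -> series c n R) : Prop :=
  (forall i, order_ge 1 (F i)) /\ bijective (substitute F).

End Substitution.

Section Automorphisms.
Variables (c : variable_kind) (n : nat) (K : comNzRingType).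

(* The coefficient of t^k, in K<<z>>, of an element of K[[t]]<<z>>. *)
Definition tslice (k : nat) (u : series c n (tseries K)) : series c n K :=
  Series (fun m => tcoef (u m) k).

(* u(tz) in K[[t]]<<z>>. *)
Definition tdilate (u : series c n K) : series c n (tseries K) :=
  Series (fun m => tmonomial (u m) (deg m)).

Definition A_t (alpha : nat) (F : 'I_n -> series c n (tseries K)) : Prop :=
  automorphism F /\
  exists H : 'I_n -> series c n (tseries K),
    [/\ forall i, F i = zvar c (tseries K) i - H i,
        forall i, order_ge alpha (H i)
      & forall i, tslice 0 (H i) = 0].

(* F_t(z) = t^-1 F(tz) is stated as t F_t(z) = F(tz). *)
Definition G_t (alpha : nat) (Ft : 'I_n -> series c n (tseries K)) : Prop :=
  A_t alpha Ft /\
  exists F : 'I_n -> series c n K,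
    automorphism F /\ forall i, tmonomial 1 1 *: Ft i = tdilate (F i).

Definition der_series (alpha : nat) (d : endo (series c n K)) : Prop :=
  derivation d /\ forall i, order_ge alpha (d (zvar c K i)).

Definition diffop_series (alpha : nat) : endo (series c n K) -> Prop :=
  generated_subalgebra (der_series alpha).

Definition diffop_poly : endo (zpoly c n K) -> Prop :=
  generated_subalgebra (@derivation K (zpoly c n K)).

Definition zpoly_homog (d : nat) (p : zpoly c n K) : Prop :=
  forall m, p@_m != 0 -> deg m = d.

Definition diffop_poly_deg (m : nat) (U : endo (zpoly c n K)) : Prop :=
  diffop_poly U /\ forall d h, zpoly_homog d h -> zpoly_homog (m + d) (U h).

Definition series_of_zpoly (p : zpoly c n K) : series c n K :=
  Series (fun m => p@_m).

Definition extends (U : endo (series c n K)) (V : endo (zpoly c n K)) : Prop :=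
  forall p, U (series_of_zpoly p) = series_of_zpoly (V p).

(* D^[alpha]<z>, an intersection of subalgebras of End(K<z>) and of          *)
(* End(K<<z>>), is seen inside End(K<<z>>).                                   *)
Definition diffop (alpha : nat) (U : endo (series c n K)) : Prop :=
  diffop_series alpha U /\ exists V, diffop_poly V /\ extends U V.

Definition diffop_deg (alpha m : nat) (U : endo (series c n K)) : Prop :=
  diffop_series alpha U /\ exists V, diffop_poly_deg m V /\ extends U V.

End Automorphisms.

Section NSym.
Variable K : comNzRingType.

Definition NSym : algType K := free_algebra K nat.

(* The generator k of NSym is Lambda_(k+1). *)
Definition Lambda (m : nat) : NSym := if m is k.+1 then free_gen K k else 1.

Definition nsym_homog (m : nat) (P : NSym) : Prop :=
  forall w, P@_w != 0 -> (\sum_(k <- fmonom_val w) k.+1)%N = m.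

(* sigma(t) = lambda(-t)^-1 and d sigma/dt = sigma(t) sum_m t^(m-1) Psi_m;   *)
(* Psi 0 plays no role.                                                      *)
Definition is_Psi (Psi : nat -> NSym) : Prop :=
  exists sigma : tseries NSym,
    let lambda_neg := tseries_of (fun m => (-1) ^+ m *: Lambda m) in
    [/\ lambda_neg * sigma = 1, sigma * lambda_neg = 1
      & tseries_of (fun m => tcoef sigma m.+1 *+ m.+1) =
        sigma * tseries_of (fun m => Psi m.+1)].

Definition is_NSym_hopf (h : hopf_algebra NSym) : Prop :=
  exists2 Psi, is_Psi Psi & forall m, (0 < m)%N -> primitive_elt h (Psi m).

End NSym.

Section Specialization.
Variables (c : variable_kind) (n : nat) (K : comNzRingType).
Local Notation End := (endo (series c n K)).

(* The operators lambda_m act on K[[t]]<<z>> coefficientwise in t. *)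
Definition specialization_seq (alpha : nat) (Ft : 'I_n -> series c n (tseries K))
    (lambda : nat -> End) : Prop :=
  [/\ lambda 0%N = 1,
      forall m, diffop_series alpha (lambda m)
    & forall u k, tslice k (substitute Ft u) =
        \sum_(m < k.+1) (-1) ^+ m *: lambda m (tslice (k - m) u)].

Definition specialization (lambda : nat -> End) : NSym K -> End :=
  free_lift (fun k => lambda k.+1).

(* The Hopf structure on D^[alpha]<<z>> is that of the enveloping algebra of *)
(* the Lie algebra of derivations Der^[alpha]<<z>>. The action of the latter *)
(* on K<<z>> need not be faithful, and the coproduct does not descend to     *)
(* operators: with one variable, x^4 d o x^3 d - x^5 d o x^2 d = x^6 d, but   *)
(* the coproducts of the two sides differ. Hence the algebra map S into      *)
(* operators is a Hopf morphism when it is induced by a Hopf morphism into   *)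
(* the enveloping algebra.                                                   *)
Definition der_uea (alpha : nat) : algType K := uea (@der_series c n K alpha).

Definition is_diffop_hopf (alpha : nat) (h : hopf_algebra (der_uea alpha)) : Prop :=
  forall d, primitive_elt h (uea_gen d).

Definition graded_hopf_morphism (alpha : nat) (hN : hopf_algebra (NSym K))
    (hD : hopf_algebra (der_uea alpha)) (S : NSym K -> End) : Prop :=
  [/\ forall P, diffop alpha (S P),
      forall m P, nsym_homog m P -> diffop_deg alpha m (S P)
    & exists f : {lrmorphism NSym K -> der_uea alpha},
        (forall P, uea_act (f P) = S P) /\ hopf_morphism hN hD f].

End Specialization.

(* Main.v *)
Require Import Defs.
From HB Require Import structures.
From mathcomp Require Import all_boot all_order all_algebra finmap.
From mathcomp Require Import boolp.
From mathcomp Require Import monalg.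

(* Write c_k u for the coefficient of t^k in u(F_t), so that c_k = (-1)^k
   lambda_k = S((-1)^k Lambda_k).

   Substitution is multiplicative, so (c_k) is a Hasse-Schmidt derivation. The
   equation defining Psi reads (m+1) c_(m+1) = - sum_(i <= m) S(Psi_(i+1)) c_(m-i),
   from which, by induction, every S(Psi_m) is a derivation; it lies in Der^[alpha]
   because no S(P) lowers the order in z. As K contains Q, the Psi_m generate
   NSym, and sending Psi_m to the class of S(Psi_m) in the enveloping algebra
   gives a Hopf morphism lifting S, for any F_t in A_t^[alpha].

   Only the grading depends on G_t^[alpha]: t F_t(z) = F(tz) says that the
   coefficient of t^k in F_t is homogeneous of degree k + 1, that is, that
   lambda_k raises degrees by exactly k on the z_i, hence everywhere. The
   derivations S(Psi_m) then preserve polynomials. Conversely, F is read off from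
   the lambda_k z_i, and it is an automorphism because z - F(z) has order at
   least 2. *)

Set Implicit Arguments.
Unset Strict Implicit.
Unset Printing Implicit Defensive.

Import GRing.Theory.
Local Open Scope ring_scope.

(** * Substitution in power series *)

(** Coefficients are given by sums cut at the degree of a monomial; this brings sums with different
    cuts to a common one. *)
Lemma big_monomials_widen c n (V : nmodType) d e (F : monomial c n -> V) :
  (d <= e)%N -> (forall a, (d < deg a)%N -> F a = 0) ->
  \sum_(a <- monomials c n e) F a = \sum_(a <- monomials c n d) F a.
Proof.
move=> lde F0; rewrite (bigID (fun a => deg a <= d)%N) /= addrC big1.
  rewrite add0r -big_filter; apply: perm_big; apply: uniq_perm.
  - exact/filter_uniq/monomials_uniq.
  - exact: monomials_uniq.
  - move=> a; rewrite mem_filter !mem_monomials.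
    by apply/andb_idr => /leq_trans; apply.
by move=> a; rewrite -ltnNge => /F0.
Qed.

Lemma big_monomials_pred1 c n (V : nmodType) d (w : monomial c n)
    (F : monomial c n -> V) :
  (deg w <= d)%N -> \sum_(a <- monomials c n d | a == w) F a = F w.
Proof.
move=> lew; rewrite -big_filter (_ : [seq _ <- _ | _] = [:: w]) ?big_seq1 //.
by rewrite (filter_pred1_uniq (monomials_uniq c n d)) // mem_monomials.
Qed.

Section SeriesOrder.
Variables (c : variable_kind) (n : nat) (R : nzRingType).
Implicit Types (u v : series c n R).

Lemma series_addE u v m : (u + v) m = u m + v m.
Proof. by []. Qed.
Lemma series_oppE u m : (- u) m = - u m.
Proof. by []. Qed.
Lemma series_oneE m : (1 : series c n R) m = (m == mone)%:R.
Proof. by []. Qed.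
Lemma series_scaleE (k : R) u m : (k *: u) m = k * u m.
Proof. by []. Qed.

Lemma series_sumE I (r : seq I) (P : pred I) (F : I -> series c n R) m :
  (\sum_(i <- r | P i) F i) m = \sum_(i <- r | P i) F i m.
Proof. by elim/big_rec2: _ => [|i x y _ <-]. Qed.

Lemma series_mulE u v m d : (deg m <= d)%N -> (u * v) m =
  \sum_(a <- monomials c n d) \sum_(b <- monomials c n d | mmul a b == m)
     u a * v b.
Proof. exact: series_mulEw. Qed.

Lemma order_ge0 u : order_ge 0 u.
Proof. by []. Qed.

Lemma order_geW a b u : (b <= a)%N -> order_ge a u -> order_ge b u.
Proof. by move=> ba ua m mb; apply: ua; exact: leq_trans mb ba. Qed.

Lemma order_geD a u v : order_ge a u -> order_ge a v -> order_ge a (u + v).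
Proof. by move=> ua va m ma; rewrite series_addE ua ?va ?addr0. Qed.

Lemma order_geN a u : order_ge a u -> order_ge a (- u).
Proof. by move=> ua m ma; rewrite series_oppE ua ?oppr0. Qed.

Lemma order_geZ a k u : order_ge a u -> order_ge a (k *: u).
Proof. by move=> ua m ma; rewrite series_scaleE ua ?mulr0. Qed.

Lemma order_geM a b u v :
  order_ge a u -> order_ge b v -> order_ge (a + b) (u * v).
Proof.
move=> ua vb m mab; rewrite (series_mulE _ _ (leqnn _)).
rewrite big1 // => x _; rewrite big1 // => y /eqP xy.
case: (ltnP (deg x) a) => [/ua->|ax]; first by rewrite mul0r.
case: (ltnP (deg y) b) => [/vb->|by']; first by rewrite mulr0.
by move: mab; rewrite -xy degM ltnNge leq_add.
Qed.

Lemma order_zvar i : order_ge 1 (zvar c (n := n) R i).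
Proof.
move=> m m0; rewrite /zvar /=; case: eqP => // mi; move: m0.
by rewrite mi /zmon /deg size_word_of_word.
Qed.

End SeriesOrder.

Lemma mmul_commuting n (a b : monomial Commuting n) : mmul a b = mmul b a.
Proof. by apply/eqP/cmP => i; rewrite !cmM addnC. Qed.

Section SeriesComm.
Variables (n : nat) (R : comNzRingType).

(** With one variable this makes K[[t]] a commutative ring, so that the substitution lemmas below
    apply to series with coefficients in K[[t]]. *)
Fact series_mulC : commutative (@GRing.mul (series Commuting n R)).
Proof.
move=> u v; apply: seriesP => m; rewrite !(series_mulE _ _ (leqnn _)).
rewrite (exchange_big_dep xpredT) //=; apply: eq_bigr => b _.
by apply: eq_big => a; rewrite 1?mmul_commuting // mulrC.
Qed.

HB.instance Definition _ :=
  GRing.PzRing_hasCommutativeMul.Build (series Commuting n R) series_mulC.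
End SeriesComm.

HB.instance Definition _ (K : comNzRingType) := GRing.ComNzRing.on (tseries K).

Definition series_monomial c n (R : nzRingType) (F : 'I_n -> series c n R)
  (w : monomial c n) : series c n R := \prod_(i <- word w) F i.

Section Substitution.
Variables (c : variable_kind) (n : nat) (R : comNzRingType).
Variable F : 'I_n -> series c n R.
Implicit Types (u v : series c n R).

Local Notation "F ^^ w" := (series_monomial F w) (at level 30).

(** In the free case the two words are equal. In the commuting case they agree up to a permutation,
    which is harmless because the series then commute as well. *)
Lemma prod_word_of_word s : \prod_(i <- word (of_word s : monomial c n)) F i =
  \prod_(i <- s) F i.
Proof.
case: c F s => [G s|G s] //; apply: perm_big; apply/allP => i _ /=.
by rewrite count_word_comm of_word_commE.
Qed.

Lemma series_monomialM a b : F ^^ (mmul a b) = F ^^ a * F ^^ b.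
Proof.
by rewrite -{1}[a]wordK -{1}[b]wordK -of_word_cat [LHS]prod_word_of_word big_cat.
Qed.

Lemma series_monomial_zmon i : F ^^ (zmon i) = F i.
Proof. by rewrite [LHS]prod_word_of_word big_seq1. Qed.

Hypothesis F1 : forall i, order_ge 1 (F i).

Lemma order_series_monomial w : order_ge (deg w) (F ^^ w).
Proof.
rewrite /deg /series_monomial; elim: (word w) => [|i s IHs].
  exact: order_ge0.
by rewrite big_cons; exact: (order_geM (F1 i) IHs).
Qed.

(** As every F_i has order at least 1, F^w has order at least the degree of w, so longer monomials
    contribute nothing at m. *)
Lemma substituteE u m d : (deg m <= d)%N ->
  substitute F u m = \sum_(w <- monomials c n d) u w * (F ^^ w) m.
Proof.
move=> led; symmetry; apply: big_monomials_widen => // w lt.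
by rewrite order_series_monomial ?mulr0.
Qed.

(** Both sides expand to the sum over a and b of u_a v_b times the coefficient of F^(ab) = F^a F^b.
    The scalars can be moved past F^a because R is commutative. *)
Lemma substituteM u v : substitute F (u * v) = substitute F u * substitute F v.
Proof.
apply: seriesP => m; set d := deg m.
transitivity (\sum_(a <- monomials c n d) \sum_(b <- monomials c n d)
   u a * v b * (F ^^ (mmul a b)) m).
  transitivity (\sum_(w <- monomials c n d) \sum_(a <- monomials c n d)
     \sum_(b <- monomials c n d | mmul a b == w) u a * v b * (F ^^ (mmul a b)) m).
    rewrite (substituteE _ (leqnn _)) big_seq [RHS]big_seq.
    apply: eq_bigr => w; rewrite mem_monomials => wd.
    rewrite (series_mulE _ _ wd) mulr_suml; apply: eq_bigr => a _.
    by rewrite mulr_suml; apply: eq_bigr => b /eqP->.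
  rewrite exchange_big; apply: eq_bigr => a _ /=.
  under eq_bigr => w _ do rewrite big_mkcond.
  rewrite exchange_big; apply: eq_bigr => b _ /=.
  rewrite -big_mkcond /=; under eq_bigl => w do rewrite eq_sym.
  (* If the degree of ab exceeds d, no w in the range equals ab, and the term itself vanishes
     because F^(ab) has order greater than d. *)
  case: (leqP (deg (mmul a b)) d) => abd; first by rewrite big_monomials_pred1.
  by rewrite order_series_monomial // mulr0 big1.
rewrite (series_mulE _ _ (leqnn _)).
transitivity (\sum_(a <- monomials c n d) \sum_(b <- monomials c n d)
  \sum_(x <- monomials c n d) \sum_(y <- monomials c n d | mmul x y == m)
    u a * v b * ((F ^^ a) x * (F ^^ b) y)).
  apply: eq_bigr => a _; apply: eq_bigr => b _.
  rewrite series_monomialM (series_mulE _ _ (leqnn _)) mulr_sumr.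
  by apply: eq_bigr => x _; rewrite mulr_sumr.
under eq_bigr => a _ do rewrite exchange_big.
rewrite exchange_big; rewrite big_seq [RHS]big_seq.
apply: eq_bigr => x; rewrite mem_monomials => xd.
under eq_bigr => a _ do rewrite exchange_big.
rewrite exchange_big; rewrite big_seq_cond [RHS]big_seq_cond.
apply: eq_bigr => y; rewrite mem_monomials => /andP[yd _].
rewrite (substituteE _ xd) (substituteE _ yd) mulr_suml; apply: eq_bigr => a _.
by rewrite mulr_sumr; apply: eq_bigr => b _; rewrite mulrACA.
Qed.

End Substitution.

(** * Power series in t *)

Arguments tcoef : simpl never.

Section TSeries.
Variable R : nzRingType.
Implicit Types a b : tseries R.

Local Notation tpow k := (of_word (nseq k ord0) : monomial Commuting 1).

Lemma deg_tpow k : deg (tpow k) = k.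
Proof. by rewrite /deg size_word_of_word size_nseq. Qed.

Lemma tpow_deg (m : monomial Commuting 1) : tpow (deg m) = m.
Proof.
rewrite -[RHS]wordK; congr of_word; rewrite /deg.
by elim: (word m) => //= i s ->; rewrite (ord1 i).
Qed.

Lemma big_tpow (V : nmodType) d (F : monomial Commuting 1 -> V) :
  \sum_(m <- monomials Commuting 1 d) F m = \sum_(i < d.+1) F (tpow i).
Proof.
rewrite -(big_mkord xpredT (fun i => F (tpow i))) -[RHS](big_map (fun i => tpow i) xpredT).
apply/perm_big/uniq_perm.
- exact: monomials_uniq.
- rewrite map_inj_uniq ?iota_uniq // => i j /(congr1 (@deg Commuting 1)).
  by rewrite !deg_tpow.
- move=> m; rewrite mem_monomials; apply/idP/mapP => [md|[i]].
    by exists (deg m); rewrite ?tpow_deg // mem_index_iota.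
  by rewrite mem_index_iota => /= id ->; rewrite deg_tpow.
Qed.

Lemma tseriesP a b : tcoef a =1 tcoef b -> a = b.
Proof. by move=> ab; apply: seriesP => m; rewrite -[m]tpow_deg; exact: ab. Qed.

Lemma tcoef_of (f : nat -> R) k : tcoef (tseries_of f) k = f k.
Proof. by rewrite /tcoef /= deg_tpow. Qed.

Lemma tcoefD a b k : tcoef (a + b) k = tcoef a k + tcoef b k.
Proof. by []. Qed.
Lemma tcoefN a k : tcoef (- a) k = - tcoef a k.
Proof. by []. Qed.
Lemma tcoef0 k : tcoef (0 : tseries R) k = 0.
Proof. by []. Qed.
Lemma tcoef_sum I (r : seq I) (P : pred I) (F : I -> tseries R) k :
  tcoef (\sum_(i <- r | P i) F i) k = \sum_(i <- r | P i) tcoef (F i) k.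
Proof. exact: series_sumE. Qed.

Lemma tcoef1 k : tcoef (1 : tseries R) k = (k == 0%N)%:R.
Proof.
rewrite /tcoef series_oneE; congr (nat_of_bool _)%:R; apply/eqP/eqP => [|->].
  by move=> /(congr1 (@deg Commuting 1)); rewrite deg_tpow deg1.
exact: of_word_nil.
Qed.

Lemma tcoefM a b k :
  tcoef (a * b) k = \sum_(i < k.+1) tcoef a i * tcoef b (k - i).
Proof.
rewrite /tcoef (series_mulE _ _ (d := k)) ?deg_tpow // big_tpow.
apply: eq_bigr => i _; rewrite (_ : \sum_(j <- _ | _) _ =
  \sum_(j <- monomials Commuting 1 k | j == tpow (k - i)) a (tpow i) * b j).
  by rewrite big_monomials_pred1 // deg_tpow leq_subr.
have ik : (i <= k)%N by rewrite -ltnS.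
apply: eq_bigl => m; apply/eqP/eqP => [im|->].
  rewrite -[LHS]tpow_deg; congr (tpow _); have := congr1 (@deg Commuting 1) im.
  by rewrite degM !deg_tpow => /(canRL (addKn _)).
by rewrite -of_word_cat -nseqD subnKC.
Qed.

Lemma tcoef_tmonomial (x : R) j k : tcoef (tmonomial x j) k = if k == j then x else 0.
Proof. exact: tcoef_of. Qed.

Lemma tcoef_tmonomialM (x : R) j a k :
  tcoef (tmonomial x j * a) k = if (j <= k)%N then x * tcoef a (k - j) else 0.
Proof.
rewrite tcoefM; case: leqP => jk; last first.
  rewrite big1 // => i _; rewrite tcoef_tmonomial; case: eqP => [ij|].
    by have := ltn_ord i; rewrite ij ltnS leqNgt jk.
  by rewrite mul0r.
rewrite (bigD1 (Ordinal (jk : j < k.+1)%N)) //= tcoef_tmonomial eqxx big1 ?addr0 //.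
move=> i; rewrite -val_eqE /= => /negbTE ij.
by rewrite /= tcoef_tmonomial ij mul0r.
Qed.

End TSeries.

(** * The coefficients in t of u(F_t) *)

Section Constant.
Variables (c : variable_kind) (n : nat) (K : comNzRingType).
Implicit Types u v : series c n K.

(** The inclusion of K<<z>> in K[[t]]<<z>>. *)
Definition tconst u : series c n (tseries K) := Series (fun m => tmonomial (u m) 0).

Lemma tslice_tconst u k : tslice k (tconst u) = if k == 0%N then u else 0.
Proof.
by apply: seriesP => m; rewrite /= tcoef_tmonomial; case: eqP.
Qed.

Lemma tsliceP (U V : series c n (tseries K)) :
  (forall k, tslice k U = tslice k V) -> U = V.
Proof.
move=> UV; apply: seriesP => m; apply: tseriesP => k.
exact: (congr1 (fun u : series c n K => u m) (UV k)).
Qed.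

Lemma tsliceM (U V : series c n (tseries K)) k :
  tslice k (U * V) = \sum_(i < k.+1) tslice i U * tslice (k - i) V.
Proof.
apply: seriesP => m; rewrite series_sumE -[LHS]/(tcoef ((U * V) m) k).
rewrite (series_mulE _ _ (leqnn _)) tcoef_sum.
under [RHS]eq_bigr => i _ do rewrite (series_mulE _ _ (leqnn _)).
rewrite [RHS]exchange_big; apply: eq_bigr => a _; rewrite tcoef_sum.
by rewrite [RHS]exchange_big; apply: eq_bigr => b _; rewrite tcoefM.
Qed.

Lemma tconstM u v : tconst (u * v) = tconst u * tconst v.
Proof.
apply: tsliceP => k; rewrite tsliceM tslice_tconst big_ord_recl tslice_tconst /=.
rewrite big1 ?addr0; last by move=> i _; rewrite tslice_tconst mul0r.
by rewrite subn0 tslice_tconst; case: eqP => //; rewrite mulr0.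
Qed.

Lemma tconst_zvar i : tconst (zvar c K i) = zvar c (tseries K) i.
Proof.
apply: seriesP => m; apply: tseriesP => k; rewrite /= tcoef_tmonomial.
by case: (m == _); rewrite ?tcoef1 ?tcoef0 ?if_same //; case: (k == _).
Qed.

End Constant.

Lemma substitute_zvar c n (R : comNzRingType) (F : 'I_n -> series c n R) i :
  (forall i, order_ge 1 (F i)) -> substitute F (zvar c R i) = F i.
Proof.
move=> F1; apply: seriesP => m.
(* The cut is raised to at least 1 so that z_i lies in the range even when m has degree 0. *)
rewrite (substituteE F1 _ (leq_maxl _ 1)) (eq_bigr (fun w =>
   if w == zmon i then series_monomial F w m else 0)); last first.
  by move=> w _ /=; case: eqP => _; rewrite ?mul1r ?mul0r.
rewrite -big_mkcond /= big_monomials_pred1 ?series_monomial_zmon //.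
by rewrite /zmon /deg size_word_of_word leq_maxr.
Qed.

Section HasseSchmidt.
Variables (c : variable_kind) (n : nat) (K : comNzRingType).
Variable Ft : 'I_n -> series c n (tseries K).
Hypothesis Ft1 : forall i, order_ge 1 (Ft i).

(** The operator c_k. *)
Definition subst_coef (k : nat) (u : series c n K) : series c n K :=
  tslice k (substitute Ft (tconst u)).

Lemma subst_coefM k u v : subst_coef k (u * v) =
  \sum_(i < k.+1) subst_coef i u * subst_coef (k - i) v.
Proof. by rewrite /subst_coef tconstM substituteM // tsliceM. Qed.

Lemma subst_coefE k u m : subst_coef k u m =
  \sum_(w <- monomials c n (deg m)) u w * tcoef (series_monomial Ft w m) k.
Proof.
rewrite /subst_coef /= tcoef_sum; apply: eq_bigr => w _.
by rewrite tcoef_tmonomialM subn0.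
Qed.

(** Only monomials w of degree at most that of m contribute to the coefficient of m, and u vanishes
    on them when m has degree below a. *)
Lemma order_subst_coef a k u : order_ge a u -> order_ge a (subst_coef k u).
Proof.
move=> ua m ma; rewrite subst_coefE big_seq big1 // => w.
by rewrite mem_monomials => wm; rewrite ua ?mul0r // (leq_ltn_trans wm).
Qed.

Lemma subst_coef_zvar k i : subst_coef k (zvar c K i) = tslice k (Ft i).
Proof. by rewrite /subst_coef tconst_zvar substitute_zvar. Qed.

(** A series constant in t has a single nonzero slice, the one of index 0, so only the last term of
    the sum defining the lambda_m remains. *)
Lemma specialization_seqE alpha (lambda : nat -> endo (series c n K)) k u :
  specialization_seq alpha Ft lambda -> (-1) ^+ k *: lambda k u = subst_coef k u.
Proof.
case=> _ _ /(_ (tconst u) k) e; rewrite /subst_coef e big_ord_recr /= subnn.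
rewrite tslice_tconst big1 ?add0r // => i _; rewrite tslice_tconst subn_eq0.
by rewrite leqNgt ltn_ord linear0 scaler0.
Qed.

End HasseSchmidt.

(** * The elements Psi_m *)

(** Both sides run over the pairs with i + j <= m, once by antidiagonals and once by rows. *)
Lemma sum_antidiagonals (V : nmodType) m (f : nat -> nat -> V) :
  \sum_(k < m.+1) \sum_(i < k.+1) f i (k - i)%N =
  \sum_(i < m.+1) \sum_(j < (m - i).+1) f i j.
Proof.
elim: m => [|m IHm]; first by rewrite !big_ord1.
rewrite big_ord_recr {}IHm [in RHS]big_ord_recr /= subnn big_ord1.
rewrite [X in _ + X = _]big_ord_recr /= subnn addrA; congr (_ + _).
rewrite -big_split; apply: eq_bigr => i _ /=.
have im : (i <= m)%N by rewrite -ltnS.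
by rewrite subSn // [RHS]big_ord_recr.
Qed.

Lemma sum_triangleC (V : nmodType) m (f : nat -> nat -> V) :
  \sum_(i < m.+1) \sum_(j < (m - i).+1) f i j =
  \sum_(j < m.+1) \sum_(i < (m - j).+1) f i j.
Proof.
rewrite -sum_antidiagonals -(sum_antidiagonals m (fun j i => f i j)).
apply: eq_bigr => k _; rewrite (reindex_inj rev_ord_inj) /=.
by apply: eq_bigr => i _; rewrite /= subSS subKn // -ltnS.
Qed.

Section TDerivative.
Variable R : nzRingType.
Implicit Types a b : tseries R.

Definition tderiv a : tseries R := tseries_of (fun m => tcoef a m.+1 *+ m.+1).

Lemma tderivM a b : tderiv (a * b) = tderiv a * b + a * tderiv b.
Proof.
apply: tseriesP => k; rewrite tcoefD tcoef_of !tcoefM.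
(* The factor k + 1 is split as i + (k + 1 - i) in each term of the Cauchy product. *)
transitivity (\sum_(i < k.+2) (tcoef a i *+ i * tcoef b (k.+1 - i)
                 + tcoef a i * (tcoef b (k.+1 - i) *+ (k.+1 - i)))).
  rewrite -sumrMnl; apply: eq_bigr => i _; rewrite mulrnAl mulrnAr -mulrnDr.
  by rewrite subnKC // -ltnS.
rewrite big_split /=; congr (_ + _).
  rewrite big_ord_recl mulr0n mul0r add0r; apply: eq_bigr => i _ /=.
  by rewrite tcoef_of subSS.
rewrite big_ord_recr /= subnn mulr0n mulr0 addr0; apply: eq_bigr => i _ /=.
by rewrite tcoef_of subSn // -ltnS.
Qed.

Lemma tderiv1 : tderiv 1 = 0.
Proof. by apply: tseriesP => k; rewrite tcoef_of tcoef1 mul0rn. Qed.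

(** Differentiating l s = 1 gives l' s + l s p = 0, where l s = 1; multiplying by l on the right
    gives l' + p l = 0. *)
Lemma tderiv_inverse l s p :
  l * s = 1 -> s * l = 1 -> tderiv s = s * p -> tderiv l = - (p * l).
Proof.
move=> ls sl ds; have /(congr1 ( *%R^~ l)) := congr1 tderiv ls.
rewrite tderiv1 mul0r tderivM ds [l * (s * p)]mulrA ls mul1r.
by rewrite mulrDl -mulrA sl mulr1 => /eqP; rewrite addr_eq0 => /eqP.
Qed.

Lemma tderiv_inverse_coef (f g : nat -> R) s :
  tseries_of f * s = 1 -> s * tseries_of f = 1 ->
  tseries_of (fun m => tcoef s m.+1 *+ m.+1) = s * tseries_of g ->
  forall m, f m.+1 *+ m.+1 = - \sum_(i < m.+1) g i * f (m - i)%N.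
Proof.
move=> ls sl ds m; have /(congr1 (tcoef^~ m)) := tderiv_inverse ls sl ds.
rewrite tcoef_of tcoefN tcoefM tcoef_of => ->; congr (- _).
by apply: eq_bigr => i _; rewrite !tcoef_of.
Qed.

End TDerivative.

(* The equation L' = - E L, for L = sum_m t^m L_m and E = sum_m t^m E_m. *)
Definition exp_recursion (K : comNzRingType) (B : algType K) (E L : nat -> B) : Prop :=
  L 0%N = 1 /\ forall m, L m.+1 *+ m.+1 = - \sum_(i < m.+1) E i * L (m - i)%N.

Lemma exp_recursion_morph (K : comNzRingType) (B B' : algType K)
    (f : {lrmorphism B -> B'}) E L :
  exp_recursion E L -> exp_recursion (f \o E) (f \o L).
Proof.
case=> L0 LS; split=> [|m] /=; first by rewrite L0 rmorph1.
rewrite -rmorphMn LS rmorphN rmorph_sum; congr (- _).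
by apply: eq_bigr => i _; rewrite rmorphM.
Qed.

(** As L_0 = 1, the last term of the sum is E_m itself, so the recursion determines E_m from the
    earlier E_i. *)
Lemma exp_recursion_inj (K : comNzRingType) (B : algType K) (E E' L : nat -> B) :
  exp_recursion E L -> exp_recursion E' L -> E =1 E'.
Proof.
case=> L0 LS [_ LS'] m; elim/ltn_ind: m => m IHm.
have /eqP := LS m; rewrite LS' eqr_opp !big_ord_recr /= subnn L0 !mulr1 => /eqP.
under eq_bigr => i _ do rewrite -IHm //.
by move=> /addrI.
Qed.

(** [inv m] stands for 1/(m+1): this is how the Q-algebra structure of K enters. *)
Section Divisible.
Variables (K : comNzRingType) (inv : nat -> K).
Hypothesis invP : forall m, inv m * m.+1%:R = 1.

Lemma scale_invP (V : lmodType K) m (x y : V) : x *+ m.+1 = y -> x = inv m *: y.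
Proof. by move=> <-; rewrite -scaler_nat scalerA invP scale1r. Qed.

Lemma mulrn_invP (V : lmodType K) m (x : V) : (inv m *: x) *+ m.+1 = x.
Proof. by rewrite -scaler_nat scalerA mulrC invP scale1r. Qed.

Lemma exp_recursion_ex (B : algType K) (E : nat -> B) :
  exists L, exp_recursion E L.
Proof.
(* L_(m+1) depends on all earlier terms, so the recursion carries the whole list L_0, ..., L_m, of
   size m + 1, and appends one entry. *)
pose next s := let m := (size s).-1 in
  inv m *: - \sum_(i < m.+1) E i * nth 0 s (m - i).
pose Ls := fix Ls m := if m is m'.+1 then rcons (Ls m') (next (Ls m')) else [:: 1].
have szL m : size (Ls m) = m.+1 by elim: m => //= m IHm; rewrite size_rcons IHm.
have nthL m j : (j <= m)%N -> nth 0 (Ls m) j = nth 0 (Ls j) j.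
  elim: m => [|m IHm]; first by rewrite leqn0 => /eqP->.
  rewrite leq_eqVlt => /orP[/eqP->//|jm] /=.
  by rewrite nth_rcons szL jm IHm.
exists (fun m => nth 0 (Ls m) m); split=> // m.
rewrite [in LHS]/= nth_rcons szL ltnn eqxx /next szL mulrn_invP; congr (- _).
by apply: eq_bigr => i _; rewrite nthL // leq_subr.
Qed.

End Divisible.

Section GeneratedSubalgebra.
Variables (K : comNzRingType) (A : algType K) (X : A -> Prop).
Local Notation G := (generated_subalgebra X).

Lemma gen_subalg0 : G 0.
Proof. by rewrite -(scale0r 1); exact/GenSubalgZ/GenSubalg1. Qed.

Lemma gen_subalgN x : G x -> G (- x).
Proof. by rewrite -scaleN1r; exact: GenSubalgZ. Qed.

Lemma gen_subalg_sum I (r : seq I) (P : pred I) (F : I -> A) :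
  (forall i, P i -> G (F i)) -> G (\sum_(i <- r | P i) F i).
Proof. by move=> GF; apply: big_ind => //; [exact: gen_subalg0|exact: GenSubalgD]. Qed.

Lemma gen_subalg_prod I (r : seq I) (P : pred I) (F : I -> A) :
  (forall i, P i -> G (F i)) -> G (\prod_(i <- r | P i) F i).
Proof. by move=> GF; apply: big_ind => //; [exact: GenSubalg1|exact: GenSubalgM]. Qed.

Lemma gen_subalg_sub (Y : A -> Prop) x :
  (forall y, Y y -> G y) -> generated_subalgebra Y x -> G x.
Proof.
move=> YG; elim=> {x} [|x /YG //|k x _|x y _ Gx _|x y _ Gx _].
- exact: GenSubalg1.
- exact: GenSubalgZ.
- exact: GenSubalgD.
- exact: GenSubalgM.
Qed.

Lemma exp_recursion_gen (inv : nat -> K) (E L : nat -> A) :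
  (forall m, inv m * m.+1%:R = 1) ->
  exp_recursion E L -> (forall i, G (E i)) -> forall m, G (L m).
Proof.
move=> invP [L0 LS] GE; elim/ltn_ind => -[|m] IHm.
  by rewrite L0; exact: GenSubalg1.
rewrite (scale_invP invP (LS m)); apply/GenSubalgZ/gen_subalgN/gen_subalg_sum.
by move=> i _; apply/GenSubalgM/IHm; rewrite // ltnS leq_subr.
Qed.
End GeneratedSubalgebra.

Lemma gen_subalg_morph (K : comNzRingType) (A B : algType K)
    (f : {lrmorphism A -> B}) (X : A -> Prop) (Y : B -> Prop) x :
  (forall y, X y -> generated_subalgebra Y (f y)) ->
  generated_subalgebra X x -> generated_subalgebra Y (f x).
Proof.
move=> XY; elim=> {x} [|x /XY //|k x _|x y _ Gx _|x y _ Gx _].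
- by rewrite rmorph1; exact: GenSubalg1.
- by rewrite linearZ; exact: GenSubalgZ.
- by rewrite rmorphD; exact: GenSubalgD.
- by rewrite rmorphM; exact: GenSubalgM.
Qed.

Lemma malg_scaleU (R : nzRingType) (M : choiceType) (k : R) (w : M) :
  << k *g w >> = k *: << w >>.
Proof. by apply/malgP => v; rewrite mcoeffZ !mcoeffU mulr_natr. Qed.

Lemma free_algebra_gen (K : comNzRingType) (T : choiceType) (x : free_algebra K T) :
  generated_subalgebra (fun y => exists t, y = free_gen K t) x.
Proof.
have -> : x = \sum_(w <- msupp x) x@_w *: (<< w >> : free_algebra K T).
  rewrite {1}[x]monalgE; apply: eq_bigr => w _.
  exact: malg_scaleU.
apply: gen_subalg_sum => w _; apply: GenSubalgZ; case: w => s.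
suff -> : << FMonom s >> = \prod_(t <- s) free_gen K t.
  by apply: gen_subalg_prod => t _; apply: GenSubalgX; exists t.
elim: s => [|t s IHs].
  have -> : FMonom [::] = mone :> {fmonom T} by rewrite /mone /one /= fmoneE.
  by rewrite big_nil.
rewrite big_cons -IHs.
have -> : FMonom (t :: s) = mmul (fmu t) (FMonom s).
  by rewrite /mmul /mul /= fmmulE fmuE.
rewrite -[RHS]/((<< fmu t >> : {malg K[{fmonom T}]}) * << FMonom s >>).
by rewrite malgM_def fgmulUU mulr1.
Qed.

Section NSym.
Variable K : comNzRingType.
Implicit Type Psi : nat -> NSym K.

(** The coefficients of lambda(-t), the inverse of sigma(t); the specialization sends them to the
    operators c_m. *)
Definition neg_Lambda m : NSym K := (-1) ^+ m *: Lambda K m.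

Lemma Lambda_neg m : Lambda K m = (-1) ^+ m *: neg_Lambda m.
Proof. by rewrite /neg_Lambda scalerA -exprD addnn -signr_odd odd_double scale1r. Qed.

Lemma Psi_recursion Psi :
  is_Psi Psi -> exp_recursion (fun i => Psi i.+1) neg_Lambda.
Proof.
case=> sigma [ls sl dsigma]; split; first by rewrite /neg_Lambda expr0 scale1r.
exact: tderiv_inverse_coef ls sl dsigma.
Qed.

(** Dividing the recursion by m + 1 expresses each Lambda_(m+1) through the Psi_i and the earlier
    Lambda_i. *)
Lemma NSym_gen (inv : nat -> K) Psi (x : NSym K) :
  (forall m, inv m * m.+1%:R = 1) -> is_Psi Psi ->
  generated_subalgebra (fun y => exists m, y = Psi m.+1) x.
Proof.
move=> invP /Psi_recursion rec; apply: gen_subalg_sub (free_algebra_gen x).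
move=> _ [m ->]; rewrite -[free_gen K m]/(Lambda K m.+1) Lambda_neg.
apply: GenSubalgZ; apply: exp_recursion_gen invP rec _ _ => i.
by apply: GenSubalgX; exists i.
Qed.
End NSym.

(** * Derivations from a Hasse-Schmidt sequence *)

Lemma endo_sumE (K : comNzRingType) (A : algType K) I (r : seq I)
    (F : I -> endo A) x : (\sum_(i <- r) F i) x = \sum_(i <- r) F i x.
Proof. by elim/big_rec2: _ => [|i y z _ <-]. Qed.

Lemma endo_mulrnE (K : comNzRingType) (A : algType K) (f : endo A) k x :
  (f *+ k) x = f x *+ k.
Proof. by elim: k => // k IHk; rewrite !mulrS -IHk. Qed.

(* The defects D_i(uv) - D_i(u)v - uD_i(v) satisfy a triangular system. *)
Lemma hasse_schmidt_derivation (K : comNzRingType) (A : algType K)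
    (D C : nat -> endo A) :
  exp_recursion D C ->
  (forall k u v, C k (u * v) = \sum_(i < k.+1) C i u * C (k - i)%N v) ->
  forall m, derivation (D m).
Proof.
case=> C0 CS CM m; elim/ltn_ind: m => m IHm u v.
have CSE k x : C k.+1 x *+ k.+1 = - \sum_(i < k.+1) D i (C (k - i)%N x).
  by rewrite -endo_mulrnE CS; exact/(congr1 -%R)/endo_sumE.
(* The Hasse-Schmidt rule says that x |-> sum_k t^k C_k x is multiplicative. Its derivative in t, at
   t^m, is then computed in two ways. *)
pose tser x : tseries A := tseries_of (fun k => C k x).
have tserM : tser (u * v) = tser u * tser v.
  apply: tseriesP => k; rewrite tcoef_of CM tcoefM.
  by apply: eq_bigr => i _; rewrite !tcoef_of.
have := congr1 (fun a => tcoef (tderiv a) m) tserM.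
rewrite /= tderivM tcoefD !tcoefM !tcoef_of CSE.
under [in X in _ = X + _]eq_bigr => i _ do
  rewrite !tcoef_of CSE mulNr mulr_suml.
under [in X in _ = _ + X]eq_bigr => i _ do
  rewrite !tcoef_of CSE mulrN mulr_sumr.
rewrite !sumrN -opprD => /oppr_inj.
(* The two halves of the Leibniz rule for D_i on the product of C_j u and C_(m-i-j) v. The two sums
   are reindexed so that i, the index of D, is outermost. *)
pose f i j := D i (C j u) * C (m - (i + j))%N v.
pose g i j := C j u * D i (C (m - (i + j))%N v).
have -> : \sum_(k < m.+1) \sum_(i < k.+1) D i (C (k - i)%N u) * C (m - k)%N v =
   \sum_(i < m.+1) \sum_(j < (m - i).+1) f i j.
  rewrite -sum_antidiagonals; apply: eq_bigr => k _; apply: eq_bigr => i _.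
  by rewrite /f subnKC // -ltnS.
have -> : \sum_(j < m.+1) \sum_(i < (m - j).+1) C j u * D i (C (m - j - i)%N v) =
   \sum_(i < m.+1) \sum_(j < (m - i).+1) g i j.
  rewrite (sum_triangleC m g); apply: eq_bigr => j _; apply: eq_bigr => i _.
  by rewrite /g addnC subnDA.
rewrite -big_split /=; under [RHS]eq_bigr => i _ do rewrite -big_split /=.
under [LHS]eq_bigr => i _ do rewrite CM linear_sum.
(* The row i = m has the single entry j = 0, where C_0 = 1, and it is the Leibniz rule for D_m. The
   rows i < m agree by induction and cancel. *)
rewrite big_ord_recr [in RHS]big_ord_recr /= subnn !big_ord1 /f /g !addn0 subnn C0 /=.
under [X in X + _ = _]eq_bigr => i _ do under eq_bigr => j _ do
  rewrite IHm // -subnDA.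
by move=> /addrI.
Qed.

(** * Hopf morphisms *)

Section TensorLift.
Variables (K : comNzRingType) (U V : lmodType K).

Lemma tensor_lift_sum (W : lmodType K) (b : U -> V -> W) I (r : seq I)
    (F : I -> tensor U V) : bilinear_map b ->
  tensor_lift b (\sum_(i <- r) F i) = \sum_(i <- r) tensor_lift b (F i).
Proof.
move=> bb; apply: (big_morph (tensor_lift b)) => [s t|].
  exact: (tensor_liftD bb).
exact: tensor_lift0.
Qed.

Lemma tensor_ind (P : tensor U V -> Prop) :
  P 0 -> (forall s t, P s -> P t -> P (s + t)) -> (forall x y, P (x ⊗ y)) ->
  forall s, P s.
Proof.
by move=> P0 PD Pxy s; rewrite [s]tensor_pureE; elim/big_ind: _ => // p _; exact: Pxy.
Qed.

Lemma tensor_liftE (W : lmodType K) (b : U -> V -> W) s :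
  tensor_lift b s = \sum_(p <- repr s) b p.1 p.2.
Proof. by []. Qed.

Lemma bilinear_tensor_lift (X W : lmodType K) (b : X -> U -> V -> W) :
  (forall u v, linear (fun x => b x u v)) -> (forall x, bilinear_map (b x)) ->
  bilinear_map (fun x s => tensor_lift (b x) s).
Proof.
move=> bx buv; split=> [s k x y|x].
  rewrite !tensor_liftE scaler_sumr -big_split; apply: eq_bigr => p _.
  exact: bx.
exact: tensor_lift_linear.
Qed.

Lemma bilinear_tensor_lift_swap (X W : lmodType K) (b : X -> U -> V -> W) :
  (forall u v, linear (fun x => b x u v)) -> (forall x, bilinear_map (b x)) ->
  bilinear_map (fun s x => tensor_lift (b x) s).
Proof. by move=> bx buv; case: (bilinear_tensor_lift bx buv). Qed.

End TensorLift.

Section TensorMap.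
Variables (K : comNzRingType) (U V U' V' : lmodType K) (f : U -> U') (g : V -> V').

Lemma tensor_mapE s : tensor_map f g s = \sum_(p <- repr s) f p.1 ⊗ g p.2.
Proof. by []. Qed.

Lemma tensor_lift_map (W : lmodType K) (b : U' -> V' -> W) s : bilinear_map b ->
  tensor_lift b (tensor_map f g s) = tensor_lift (fun x y => b (f x) (g y)) s.
Proof.
move=> bb; rewrite tensor_mapE tensor_lift_sum //; apply: eq_bigr => p _.
exact: tensor_lift_pure.
Qed.

Lemma bilinear_tensor_map :
  linear f -> linear g -> bilinear_map (fun x y => f x ⊗ g y).
Proof.
move=> lf lg; split=> [y|x] k a b; rewrite ?lf ?lg.
  exact: (pure_tensor_bilinear U' V').1.
exact: (pure_tensor_bilinear U' V').2.
Qed.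

End TensorMap.

(** Both sides are additive in s and in t, which reduces the claim to pure tensors. *)
Lemma tensor_mapM (K : comNzRingType) (A B A' B' : algType K)
    (f : {lrmorphism A -> A'}) (g : {lrmorphism B -> B'}) (s t : tensor A B) :
  tensor_map f g (s * t) = tensor_map f g s * tensor_map f g t.
Proof.
have bfg : bilinear_map (fun x y => f x ⊗ g y).
  by apply: bilinear_tensor_map; exact: linearP.
have fgD (x y : tensor A B) :
    tensor_map f g (x + y) = tensor_map f g x + tensor_map f g y.
  exact: (tensor_liftD bfg).
have fg0 : tensor_map f g (0 : tensor A B) = 0 by exact: (tensor_lift0 bfg).
have fgp x y : tensor_map f g (x ⊗ y) = f x ⊗ g y by exact: (tensor_lift_pure bfg).
have mulp (C D : algType K) x y x' y' :
    (x ⊗ y : tensor C D) * (x' ⊗ y') = (x * x') ⊗ (y * y').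
  exact: tensor_mul_pure.
elim/tensor_ind: s => [|s s' IHs IHs'|x y].
- by rewrite fg0 !mul0r fg0.
- by rewrite mulrDl !fgD IHs IHs' mulrDl.
elim/tensor_ind: t => [|t t' IHt IHt'|x' y'].
- by rewrite fg0 !mulr0 fg0.
- by rewrite mulrDr !fgD IHt IHt' mulrDr.
by rewrite mulp !fgp mulp !rmorphM.
Qed.

Section HopfMorphism.
Variables (K : comNzRingType) (H H' : algType K).
Variables (h : hopf_algebra H) (h' : hopf_algebra H') (f : {lrmorphism H -> H'}).

(* The antipode is the convolution inverse of the identity. *)
Lemma hopf_morphism_antipode :
  (forall x, comul h' (f x) = tensor_map f f (comul h x)) ->
  (forall x, counit h' (f x) = counit h x) ->
  forall x, antipode h' (f x) = f (antipode h x).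
Proof.
move=> fcomul fcounit x.
(* T is evaluated on the threefold coproduct of x, bracketed in the two ways allowed by
   coassociativity: one gives f(S x), the other S'(f x). *)
pose T a b c := antipode h' (f a) * f b * f (antipode h c).
have Ta b c : linear (fun a => T a b c).
  by move=> k a a'; rewrite /T !linearP !mulrDl -!scalerAl.
have Tbc a : bilinear_map (T a).
  split=> [c|b] k u u'; rewrite /T !linearP mulrDr -scalerAr //.
  by rewrite mulrDl -scalerAl.
have Tb a : bilinear_map (fun b c => T a b c) by exact: Tbc.
have bT : bilinear_map (fun a s => tensor_lift (T a) s).
  exact: bilinear_tensor_lift.
have bass : bilinear_map (fun (s : tensor H H) (z : H) =>
    tensor_lift (fun x y => x ⊗ (y ⊗ z)) s).
  apply: (bilinear_tensor_lift_swap (b := fun z x y => x ⊗ (y ⊗ z))) => [u v|z].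
    move=> k a b; rewrite (pure_tensor_bilinear _ _).2.
    exact: (pure_tensor_bilinear _ _).2.
  split=> [v|u] k a b; first exact: (pure_tensor_bilinear _ _).1.
  rewrite (pure_tensor_bilinear _ _).1.
  exact: (pure_tensor_bilinear _ _).2.
have bS' : bilinear_map (fun y z => antipode h' y * z).
  split=> [z|y] k a b; first by rewrite linearP mulrDl -scalerAl.
  by rewrite mulrDr -scalerAr.
have := congr1 (tensor_lift (fun a s => tensor_lift (T a) s)) (hopf_coassoc h x).
rewrite tensor_lift_map //= /tensor_assoc tensor_lift_map //=.
rewrite [X in tensor_lift _ X = _]tensor_liftE [RHS]tensor_liftE.
rewrite (tensor_lift_sum _ _ bT).
(* Left bracketing: f respects the coproduct, so the first two factors of T collapse by the antipode
   axiom of H'. *)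
have -> : \sum_(p <- repr (comul h x)) tensor_lift (fun a s => tensor_lift (T a) s)
     (tensor_lift (fun x y => x ⊗ (y ⊗ p.2)) (comul h p.1)) =
   \sum_(p <- repr (comul h x)) f (antipode h (counit h p.1 *: p.2)).
  apply: eq_bigr => p _; rewrite [X in tensor_lift _ X = _]tensor_liftE (tensor_lift_sum _ _ bT).
  transitivity (tensor_lift (fun y z => antipode h' y * z) (comul h' (f p.1))
      * f (antipode h p.2)).
    rewrite fcomul tensor_lift_map // tensor_liftE mulr_suml.
    by apply: eq_bigr => q _; rewrite !tensor_lift_pure.
  by rewrite hopf_antipodel fcounit mulr_algl !linearZ.
(* Right bracketing: the last two factors are the image under f of the antipode axiom of H. *)
have -> : \sum_(p <- repr (comul h x)) tensor_lift (T p.1) (comul h p.2) =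
   \sum_(p <- repr (comul h x)) antipode h' (f (counit h p.2 *: p.1)).
  apply: eq_bigr => p _.
  transitivity (antipode h' (f p.1) *
     f (tensor_lift (fun y z => y * antipode h z) (comul h p.2))).
    rewrite !tensor_liftE linear_sum mulr_sumr; apply: eq_bigr => q _ /=.
    by rewrite /T rmorphM mulrA.
  by rewrite hopf_antipoder linearZ /= rmorph1 mulr_algr !linearZ.
rewrite -!linear_sum -(tensor_liftE (fun y z => counit h y *: z)) hopf_counitl.
by rewrite -(tensor_liftE (fun y z => counit h z *: y)) hopf_counitr.
Qed.

(** Coproduct and counit are algebra maps, so they can be compared on generators. The antipode is
    not given as one, and its compatibility follows from theirs. *)
Lemma hopf_morphism_gen (X : H -> Prop) :
  (forall x, generated_subalgebra X x) ->
  (forall x, X x -> primitive_elt h x /\ primitive_elt h' (f x)) ->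
  hopf_morphism h h' f.
Proof.
move=> genX primX.
have bff : bilinear_map (fun x y => f x ⊗ f y).
  by apply: bilinear_tensor_map; exact: linearP.
have linff : linear (tensor_map f f) by exact: tensor_lift_linear.
have fD s t : tensor_map f f (s + t) = tensor_map f f s + tensor_map f f t.
  exact: (tensor_liftD bff).
have fZ k s : tensor_map f f (k *: s) = k *: tensor_map f f s.
  exact: (tensor_liftZ bff).
have fcounit x : counit h' (f x) = counit h x.
  elim: (genX x) => {x} [|x /primX[[_ -> _] [_ -> _]] //|k x _|x y _ Gx _|x y _ Gx _].
  - by rewrite !rmorph1.
  - by rewrite !linearZ /= => ->.
  - by rewrite !rmorphD /= Gx => ->.
  - by rewrite !rmorphM /= Gx => ->.
have fcomul x : comul h' (f x) = tensor_map f f (comul h x).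
  elim: (genX x) => {x} [|x /primX[[-> _ _] [-> _ _]]|k x _|x y _ Gx _|x y _ Gx _].
  - rewrite !rmorph1 -[1 : tensor H H]/(1 ⊗ 1) /tensor_map tensor_lift_pure //.
    by rewrite rmorph1.
  - by rewrite fD /tensor_map !tensor_lift_pure // rmorph1.
  - by rewrite !linearZ /= fZ => ->.
  - by rewrite !rmorphD /= Gx => ->; rewrite -fD.
  - by rewrite !rmorphM /= Gx => ->; rewrite -tensor_mapM.
by split=> //; exact: hopf_morphism_antipode.
Qed.

End HopfMorphism.

Section UeaAct.
Variables (K : comNzRingType) (A : algType K) (L : A -> Prop).

Fact uea_act_linear : linear (@uea_act K A L).
Proof.
move=> k; elim/uea_ind => p; elim/uea_ind => q.
have -> : k *: (\pi_(uea L) p)%qT + (\pi_(uea L) q)%qT = (\pi_(uea L) (k *: p + q))%qT.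
  by rewrite uea_piD uea_piZ.
by rewrite !uea_act_pi linearP.
Qed.
HB.instance Definition _ :=
  GRing.isLinear.Build K (uea L) A *:%R (@uea_act K A L) uea_act_linear.

Fact uea_act_monoid_morphism : monoid_morphism (@uea_act K A L).
Proof.
split; first by rewrite -[1]/((\pi_(uea L) 1)%qT) uea_act_pi rmorph1.
elim/uea_ind => p; elim/uea_ind => q.
have -> : (\pi_(uea L) p)%qT * (\pi_(uea L) q)%qT = (\pi_(uea L) (p * q))%qT.
  by rewrite uea_piM.
by rewrite !uea_act_pi rmorphM.
Qed.
HB.instance Definition _ :=
  GRing.isMonoidMorphism.Build (uea L) A (@uea_act K A L) uea_act_monoid_morphism.

Lemma uea_act_gen (x : lie_elt L) : uea_act (uea_gen x) = lie_val x.
Proof. by rewrite uea_act_pi free_lift_gen. Qed.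

End UeaAct.

Lemma eq_lrmorph_gen (K : comNzRingType) (A B : algType K) (f g : {lrmorphism A -> B})
    (X : A -> Prop) x :
  (forall y, X y -> f y = g y) -> generated_subalgebra X x -> f x = g x.
Proof.
move=> XE; elim=> {x} [|x /XE //|k x _ IH|x y _ IHx _ IHy|x y _ IHx _ IHy].
- by rewrite !rmorph1.
- by rewrite !linearZ /= IH.
- by rewrite !rmorphD /= IHx IHy.
- by rewrite !rmorphM /= IHx IHy.
Qed.

(** * The specialization *)

Section LastTerm.
Variables (K : comNzRingType) (A : algType K) (D C : nat -> endo A).
Hypothesis DC : exp_recursion D C.

Lemma exp_recursion_last m x :
  D m x = - (C m.+1 x *+ m.+1) - \sum_(i < m) D i (C (m - i)%N x).
Proof.
have -> : D m = - (C m.+1 *+ m.+1) - \sum_(i < m) D i * C (m - i)%N.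
  by case: DC => C0 ->; rewrite big_ord_recr /= subnn C0 mulr1 opprK [X in X - _]addrC addrK.
rewrite -endo_mulrnE.
by rewrite -[RHS]/(_ - _) -(endo_sumE _ (fun i : 'I_m => D i * C (m - i)%N)).
Qed.

(** The recursion is solved for D_m, whose coefficient is C_0 = 1. It serves both for the order and
    for the homogeneity of S(Psi_m). *)
Lemma endo_add_last (P : A -> Prop) m x :
  (forall u v, P u -> P v -> P (u + v)) -> (forall u, P u -> P (- u)) -> P 0 ->
  P (C m.+1 x) -> (forall i, (i < m)%N -> P (D i (C (m - i)%N x))) -> P (D m x).
Proof.
move=> PD PN P0 PC PDC; rewrite exp_recursion_last; apply: (PD).
  apply: PN; elim: {2}m.+1 => [|k IHk]; first by rewrite mulr0n.
  by rewrite mulrS; exact: PD.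
by apply: PN; apply: big_ind => // i _; exact: PDC.
Qed.
End LastTerm.

Section Specialization.
Variables (c : variable_kind) (n : nat) (K : comNzRingType).
Variables (inv : nat -> K).
Hypothesis invP : forall m, inv m * m.+1%:R = 1.
Variables (alpha : nat) (Ft : 'I_n -> series c n (tseries K)).
Hypothesis A_Ft : A_t alpha Ft.
Variable lambda : nat -> endo (series c n K).
Hypothesis lambdaP : specialization_seq alpha Ft lambda.

(** The function [specialization lambda], typed as an algebra morphism. *)
Definition spec_morph : {lrmorphism NSym K -> endo (series c n K)} :=
  free_lift (fun k => lambda k.+1).
Local Notation S := spec_morph.

Lemma A_t_order1 i : order_ge 1 (Ft i).
Proof. by case: A_Ft => -[F1 _] _; exact: F1. Qed.

Lemma spec_Lambda k : S (Lambda K k) = lambda k.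
Proof.
case: k => [|k]; last exact: free_lift_gen.
by rewrite rmorph1; case: lambdaP => ->.
Qed.

Lemma spec_neg_Lambda k u : S (neg_Lambda K k) u = subst_coef Ft k u.
Proof. by rewrite -(specialization_seqE k u lambdaP) linearZ /= spec_Lambda. Qed.

Lemma spec_gen P : generated_subalgebra (fun U => exists k, U = lambda k) (S P).
Proof.
apply: gen_subalg_morph (free_algebra_gen P) => _ [k ->]; apply: GenSubalgX.
by exists k.+1; exact: (spec_Lambda k.+1).
Qed.

Lemma spec_diffop_series P : diffop_series alpha (S P).
Proof.
apply: gen_subalg_sub (spec_gen P) => _ [k ->].
by case: lambdaP => _ /(_ k).
Qed.

(** The image of S is generated by the lambda_k, and lambda_k is c_k up to sign, which does not
    lower the order. *)
Lemma spec_order a P u : order_ge a u -> order_ge a (S P u).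
Proof.
elim: (spec_gen P) u => {P} [|U [k ->]|k U _ IH|U V _ IHU _ IHV|U V _ IHU _ IHV] u ua //.
- rewrite -spec_Lambda Lambda_neg linearZ; apply: order_geZ.
  by rewrite spec_neg_Lambda; apply: order_subst_coef ua.
- by apply: order_geZ; exact: IH.
- by apply: order_geD; [exact: IHU|exact: IHV].
- by apply: IHU; exact: IHV.
Qed.

(** For k > 0 the coefficient of t^k in z_i - H_i comes from -H_i alone, whose order is at least
    alpha. *)
Lemma order_subst_coef_zvar k i : (0 < k)%N ->
  order_ge alpha (subst_coef Ft k (zvar c K i)).
Proof.
case: A_Ft => _ [H [FH Halpha _]] k0.
rewrite subst_coef_zvar; last exact: A_t_order1.
move=> m ma; rewrite /= FH series_addE tcoefD -tconst_zvar /= tcoef_tmonomial.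
by rewrite eqn0Ngt k0 add0r tcoefN Halpha ?tcoef0 ?oppr0.
Qed.

Variable Psi : nat -> NSym K.
Hypothesis PsiP : is_Psi Psi.

Lemma spec_recursion :
  exp_recursion (fun i => S (Psi i.+1)) (fun k => S (neg_Lambda K k)).
Proof. exact: (exp_recursion_morph S (Psi_recursion PsiP)). Qed.

Lemma spec_Psi_derivation m : derivation (S (Psi m.+1)).
Proof.
have CM k u v : S (neg_Lambda K k) (u * v) =
    \sum_(i < k.+1) S (neg_Lambda K i) u * S (neg_Lambda K (k - i)) v.
  apply: etrans (spec_neg_Lambda k _) _; apply: etrans (subst_coefM A_t_order1 k _ _) _.
  by apply: eq_bigr => i _; apply: (congr2 *%R); exact/esym/spec_neg_Lambda.
exact: (hasse_schmidt_derivation spec_recursion CM m).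
Qed.

Lemma spec_Psi_der_series m : der_series alpha (S (Psi m.+1)).
Proof.
split=> [|i]; first exact: spec_Psi_derivation.
apply: (endo_add_last spec_recursion (P := order_ge alpha)) => //.
- exact: order_geD.
- exact: order_geN.
- by rewrite spec_neg_Lambda; exact: order_subst_coef_zvar.
(* As m - j > 0, the series c_(m-j) z_i has order at least alpha, and S(Psi_(j+1)) keeps it
   there. *)
- move=> j jm; apply: spec_order; rewrite spec_neg_Lambda.
  by apply: order_subst_coef_zvar; rewrite subn_gt0.
Qed.

Definition spec_lie m : lie_elt (@der_series c n K alpha) :=
  exist _ (S (Psi m.+1)) (spec_Psi_der_series m) : {x | der_series alpha x}.

(** A morphism on NSym is given freely on the Lambda_k but is prescribed here on the Psi_m. So the
    recursion is solved in the enveloping algebra with E_i the class of S(Psi_(i+1)); its solution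
    gives the images of the (-1)^k Lambda_k, and since the recursion determines E, f takes the
    prescribed values. *)
Lemma spec_lift : exists f : {lrmorphism NSym K -> der_uea c n K alpha},
  (forall P, uea_act (f P) = S P) /\
  (forall m, f (Psi m.+1) = uea_gen (spec_lie m)).
Proof.
have [L recL] := exp_recursion_ex invP (fun i => uea_gen (spec_lie i)).
pose f : {lrmorphism NSym K -> der_uea c n K alpha} :=
  free_lift (fun k => (-1) ^+ k.+1 *: L k.+1).
have fneg k : f (neg_Lambda K k) = L k.
  have -> : f (neg_Lambda K k) = (-1) ^+ k *: f (Lambda K k) by exact: linearZ.
  case: k => [|k].
    by rewrite rmorph1 /= expr0 scale1r; case: recL.
  have -> : f (Lambda K k.+1) = (-1) ^+ k.+1 *: L k.+1 by exact: free_lift_gen.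
  rewrite /= scalerA -exprD addnn -signr_odd odd_double.
  exact: scale1r.
have fPsi m : f (Psi m.+1) = uea_gen (spec_lie m).
  have recf := exp_recursion_morph f (Psi_recursion PsiP).
  have Lneg : f \o neg_Lambda K = L by exact: funext.
  by rewrite Lneg in recf; exact: (exp_recursion_inj recf recL m).
exists f; split=> // P.
(* The action composed with f agrees with S on the Psi_m, which generate. *)
pose g : {lrmorphism NSym K -> endo (series c n K)} := @uea_act _ _ _ \o f.
apply: (eq_lrmorph_gen (f := g)) (NSym_gen P invP PsiP) => _ [m ->].
by rewrite [LHS]/= fPsi; exact: (uea_act_gen (spec_lie m)).
Qed.

Lemma spec_hopf (hN : hopf_algebra (NSym K)) (hD : hopf_algebra (der_uea c n K alpha)) :
  (forall m, (0 < m)%N -> primitive_elt hN (Psi m)) -> is_diffop_hopf hD ->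
  exists f : {lrmorphism NSym K -> der_uea c n K alpha},
    (forall P, uea_act (f P) = S P) /\ hopf_morphism hN hD f.
Proof.
move=> primN primD; have [f [fS fPsi]] := spec_lift; exists f; split=> //.
apply: hopf_morphism_gen (fun x => NSym_gen x invP PsiP) _ => _ [m ->].
by split; [exact: primN|rewrite fPsi; exact: primD].
Qed.

End Specialization.

(** * Homogeneity *)

Section Polynomials.
Variables (c : variable_kind) (n : nat) (K : comNzRingType).
Local Notation sz := (@series_of_zpoly c n K).

Lemma series_of_zpoly_inj : injective sz.
Proof.
move=> p q pq; apply/malgP => m.
exact: (congr1 (fun u : series c n K => u m) pq).
Qed.

Lemma series_of_zpoly_linear k p q : sz (k *: p + q) = k *: sz p + sz q.
Proof. by apply: seriesP => m /=; rewrite mcoeffD mcoeffZ. Qed.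

Lemma deg_bounded_zpoly (p : zpoly c n K) :
  exists N, forall m, (N < deg m)%N -> sz p m = 0.
Proof.
exists (\max_(m <- msupp p) deg m)%N => m; rewrite ltnNge => mN; apply/eqP.
apply: contraNT mN => /= pm; apply: (leq_bigmax_seq _ (F := @deg c n)) => //.
by rewrite -mcoeff_neq0.
Qed.

Lemma zpoly_of_deg_bounded N (u : series c n K) :
  (forall m, (N < deg m)%N -> u m = 0) -> exists p, sz p = u.
Proof.
move=> uN; exists (\sum_(w <- monomials c n N) << u w *g w >>).
apply: seriesP => m; rewrite /= raddf_sum /=.
rewrite (eq_bigr (fun w => if w == m then u w else 0)); last first.
  by move=> w _; rewrite mcoeffU; case: eqP.
rewrite -big_mkcond /=; case: (leqP (deg m) N) => mN.
  by rewrite big_monomials_pred1.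
rewrite big_seq_cond big1 ?uN // => w /andP[]; rewrite mem_monomials => wN /eqP wm.
by move: mN; rewrite -wm ltnNge wN.
Qed.

Lemma series_of_zpolyM p q : sz (p * q) = sz p * sz q.
Proof.
have [Np pN] := deg_bounded_zpoly p; have [Nq qN] := deg_bounded_zpoly q.
(* The product of polynomials sums over supports, that of series over all monomials up to a degree.
   The bound d covers m and both supports, so the former sums can be padded with zeros. *)
apply: seriesP => m; set d := maxn (deg m) (maxn Np Nq).
have suppE (r : zpoly c n K) N (V : nmodType) (F : monomial c n -> V) :
    (forall m, (N < deg m)%N -> sz r m = 0) -> (N <= d)%N ->
    (forall m, r@_m = 0 -> F m = 0) ->
    \sum_(w <- msupp r) F w = \sum_(w <- monomials c n d) F w.
  move=> rN Nd F0; rewrite [RHS](bigID (mem (msupp r))) /= addrC [X in _ = X + _]big1 ?add0r.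
    rewrite -[RHS]big_filter; apply: perm_big; apply: uniq_perm.
    - exact: fset_uniq.
    - exact/filter_uniq/monomials_uniq.
    - move=> w; rewrite mem_filter; symmetry; apply: andb_idr => wr.
      rewrite mem_monomials (leq_trans _ Nd) // leqNgt; apply/negP => /rN/eqP.
      by rewrite /= mcoeff_eq0 wr.
  by move=> w; rewrite -mcoeff_eq0 => /eqP; exact: F0.
rewrite (series_mulE _ _ (leq_maxl _ _ : (deg m <= d)%N)).
rewrite -[LHS]/(((p : {malg K[monomial c n]}) * (q : {malg K[monomial c n]}))@_m).
rewrite mcoeffMl (suppE _ _ _ _ pN) ?leq_max ?leqnn ?orbT //; last first.
  by move=> a pa; apply: big1 => b _; rewrite pa mul0r mul0rn.
apply: eq_bigr => a _; rewrite (suppE _ _ _ _ qN) ?leq_max ?leqnn ?orbT //; last first.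
  by move=> b qb; rewrite qb mulr0 mul0rn.
by rewrite [RHS]big_mkcond; apply: eq_bigr => b _ /=; case: (_ == m).
Qed.

End Polynomials.

Section Homogeneous.
Variables (c : variable_kind) (n : nat) (K : comNzRingType).
Implicit Types (u v : series c n K) (U : endo (series c n K)).
Implicit Types (V : endo (zpoly c n K)).

Definition series_homog (d : nat) u := forall m, deg m != d -> u m = 0.

Definition endo_homog (e : nat) U :=
  forall (d : nat) u, series_homog d u -> series_homog (e + d)%N (U u).

Lemma series_homogD d u v :
  series_homog d u -> series_homog d v -> series_homog d (u + v).
Proof. by move=> ud vd m md; rewrite series_addE ud ?vd ?addr0. Qed.

Lemma series_homogN d u : series_homog d u -> series_homog d (- u).
Proof. by move=> ud m md; rewrite series_oppE ud ?oppr0. Qed.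

Lemma series_homogZ d k u : series_homog d u -> series_homog d (k *: u).
Proof. by move=> ud m md; rewrite series_scaleE ud ?mulr0. Qed.

(** A series of degree at most N is the finite sum of its components of degree d <= N, and U sends
    each to degree e + d. *)
Lemma deg_bounded_endo (e : nat) U N u : endo_homog e U ->
  (forall m, (N < deg m)%N -> u m = 0) ->
  forall m, (e + N < deg m)%N -> U u m = 0.
Proof.
move=> Ue uN m mN.
pose comp d : series c n K := Series (fun m => if deg m == d then u m else 0).
have -> : u = \sum_(d < N.+1) comp d.
  apply: seriesP => w; rewrite series_sumE /=; case: (leqP (deg w) N) => wN.
    rewrite (bigD1 (Ordinal (wN : (deg w < N.+1)%N))) //= eqxx big1 ?addr0 // => i.
    by rewrite -val_eqE /= eq_sym => /negbTE->.
  by rewrite uN // big1 // => i _; rewrite if_same.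
rewrite linear_sum series_sumE big1 // => d _; apply: (Ue d).
  by move=> w /negbTE /= ->.
apply: contraTneq mN => ->; rewrite -leqNgt leq_add2l.
by rewrite -ltnS.
Qed.

(** The image of a polynomial has bounded degree, hence is a polynomial. It is picked by choice, and
    linearity holds because a polynomial is determined by its series. *)
Lemma endo_homog_restrict e U : endo_homog e U ->
  exists V : endo (zpoly c n K), extends U V.
Proof.
move=> Ue.
have exV p : exists q, series_of_zpoly q = U (series_of_zpoly p).
  have [N pN] := deg_bounded_zpoly p.
  exact: zpoly_of_deg_bounded (deg_bounded_endo Ue pN).
pose V p := projT1 (cid (exV p)).
have VE p : series_of_zpoly (V p) = U (series_of_zpoly p) by rewrite /V; case: cid.
have Vlin : linear (V : zpoly c n K -> zpoly c n K).
  move=> k p q; apply: series_of_zpoly_inj.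
  by rewrite VE !series_of_zpoly_linear linearP !VE.
by exists (Endo Vlin) => p; rewrite VE.
Qed.

Lemma derivation_restrict U V : derivation U -> extends U V -> derivation V.
Proof.
move=> dU UV p q; apply: series_of_zpoly_inj.
rewrite -UV series_of_zpolyM dU !UV -!series_of_zpolyM.
by apply: seriesP => m /=; rewrite mcoeffD.
Qed.

Lemma extends_homog e U V : endo_homog e U -> extends U V ->
  forall d h, zpoly_homog d h -> zpoly_homog (e + d) (V h).
Proof.
move=> Ue UV d h hd m; rewrite -[(V h)@_m]/(series_of_zpoly (V h) m) -UV => Vm.
apply/eqP; apply: contraNT Vm => md; apply/eqP; apply: (Ue d) md => w wd /=.
by apply/eqP; apply: contraNT wd => /hd ->.
Qed.

End Homogeneous.

Section TwistedHomogeneous.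
Variables (c : variable_kind) (n : nat) (K : comNzRingType).
Implicit Types (U V : series c n (tseries K)) (Ft : 'I_n -> series c n (tseries K)).

(* U is homogeneous of degree e when t has degree -1. *)
Definition tz_homog (e : nat) U := forall m k, deg m != (e + k)%N -> tcoef (U m) k = 0.

Lemma tz_homog1 : tz_homog 0 1.
Proof.
move=> m k mk; rewrite series_oneE; case: eqP => [m1|_]; last exact: tcoef0.
by rewrite tcoef1; move: mk; rewrite m1 deg1 eq_sym => /negbTE->.
Qed.

Lemma tz_homogM (e e' : nat) U V : tz_homog e U -> tz_homog e' V -> tz_homog (e + e')%N (U * V).
Proof.
move=> Ue Ve m k mk; rewrite (series_mulE _ _ (leqnn _)) tcoef_sum big1 // => a _.
rewrite tcoef_sum big1 // => b /eqP ab; rewrite tcoefM big1 // => i _.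
have ik : (i <= k)%N by rewrite -ltnS.
have [ai|/Ue->] := eqVneq (deg a) (e + i)%N; last by rewrite mul0r.
have [bi|/Ve->] := eqVneq (deg b) (e' + (k - i))%N; last by rewrite mulr0.
by move: mk; rewrite -ab degM ai bi addnACA subnKC ?eqxx.
Qed.

Lemma tz_homog_monomial Ft w :
  (forall i, tz_homog 1 (Ft i)) -> tz_homog (deg w) (series_monomial Ft w).
Proof.
move=> F1; rewrite /deg /series_monomial; elim: (word w) => [|i s IHs].
  by rewrite big_nil; exact: tz_homog1.
by rewrite big_cons; exact: tz_homogM (F1 i) IHs.
Qed.

(** For w of degree d, F_t^w is homogeneous of degree d when t has degree -1, so its coefficient of
    t^k has degree k + d in z. *)
Lemma tz_homog_subst_coef Ft k d u : (forall i, tz_homog 1 (Ft i)) ->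
  series_homog d u -> series_homog (k + d)%N (subst_coef Ft k u).
Proof.
move=> F1 ud m mkd; rewrite subst_coefE big1 // => w _.
have [wd|/ud->] := eqVneq (deg w) d; last by rewrite mul0r.
by rewrite (tz_homog_monomial F1) ?mulr0 // wd addnC.
Qed.

Lemma G_t_tz_homog alpha Ft i : G_t alpha Ft -> tz_homog 1 (Ft i).
Proof.
case=> _ [F [_ FtF]] m k mk.
(* The coefficient of t^(k+1) in t F_t is that of t^k in F_t, while in F(tz) the monomial m occurs
   with t^(deg m) alone. *)
have /(congr1 (fun U : series c n (tseries K) => tcoef (U m) k.+1)) := FtF i.
rewrite series_scaleE tcoef_tmonomialM mul1r subSS subn0 ltnS leq0n => ->.
by rewrite tcoef_tmonomial eq_sym -add1n (negbTE mk).
Qed.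

End TwistedHomogeneous.

Section EndoHomog.
Variables (c : variable_kind) (n : nat) (K : comNzRingType).
Implicit Types U V : endo (series c n K).

Lemma endo_homog1 : endo_homog 0 (1 : endo (series c n K)).
Proof. by []. Qed.

Lemma endo_homogM (e e' : nat) U V : endo_homog e U -> endo_homog e' V ->
  endo_homog (e + e')%N (U * V).
Proof. by move=> Ue Ve d u ud; rewrite -addnA; apply: Ue; exact: Ve. Qed.

Lemma endo_homog_sum e I (r : seq I) (P : pred I) (F : I -> endo (series c n K)) :
  (forall i, P i -> endo_homog e (F i)) -> endo_homog e (\sum_(i <- r | P i) F i).
Proof.
move=> Fe; apply: (big_ind (endo_homog e)) => // U V Ue Ve d u ud.
by apply: series_homogD; [exact: Ue|exact: Ve].
Qed.

Lemma endo_homogZ e k U : endo_homog e U -> endo_homog e (k *: U).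
Proof. by move=> Ue d u ud; apply: series_homogZ; exact: Ue. Qed.

End EndoHomog.

Section Graded.
Variables (c : variable_kind) (n : nat) (K : comNzRingType).
Variables (inv : nat -> K).
Hypothesis invP : forall m, inv m * m.+1%:R = 1.
Variables (alpha : nat) (Ft : 'I_n -> series c n (tseries K)).
Hypothesis A_Ft : A_t alpha Ft.
Variable lambda : nat -> endo (series c n K).
Hypothesis lambdaP : specialization_seq alpha Ft lambda.
Hypothesis homog_Ft : forall i, tz_homog 1 (Ft i).
Local Notation S := (spec_morph lambda).

Lemma neg_Lambda_homog k : endo_homog k (S (neg_Lambda K k)).
Proof.
move=> d u ud m mkd; apply: etrans (congr1 (fun u => scoef u m) _) _.
  exact: (spec_neg_Lambda lambdaP k u).
exact: (tz_homog_subst_coef homog_Ft ud).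
Qed.

Lemma lambda_homog k : endo_homog k (lambda k).
Proof.
rewrite -(spec_Lambda lambdaP) Lambda_neg linearZ.
exact/endo_homogZ/neg_Lambda_homog.
Qed.

Lemma spec_homog m P : nsym_homog m P -> endo_homog m (S P).
Proof.
move=> Pm; rewrite -[S P]/(\sum_(w <- msupp P) P@_w *: \prod_(k <- fmonom_val w) lambda k.+1).
rewrite big_seq; apply: endo_homog_sum => w; rewrite -mcoeff_neq0 => /Pm <-.
apply: endo_homogZ; elim: (fmonom_val w) => [|k s IHs].
  by rewrite !big_nil; exact: endo_homog1.
rewrite !big_cons; apply: endo_homogM IHs; exact: lambda_homog.
Qed.

Variable Psi : nat -> NSym K.
Hypothesis PsiP : is_Psi Psi.

Lemma spec_Psi_homog m : endo_homog m.+1 (S (Psi m.+1)).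
Proof.
elim/ltn_ind: m => m IHm d u ud.
apply: (endo_add_last (spec_recursion lambda PsiP) (P := series_homog (m.+1 + d))) => //.
- exact: series_homogD.
- exact: series_homogN.
- exact: neg_Lambda_homog.
- move=> i im; have -> : (m.+1 + d = i.+1 + (m - i + d))%N.
    by rewrite addnA [(i.+1 + _)%N]addSn subnKC // ltnW.
  by apply: (IHm i im); exact: neg_Lambda_homog.
Qed.

(** P is written in the Psi_m rather than the Lambda_m because the S(Psi_m) are homogeneous
    derivations: they restrict to derivations of K<z>, which generate the required operators. *)
Lemma spec_diffop_poly P : exists V, diffop_poly V /\ extends (S P) V.
Proof.
elim: (NSym_gen P invP PsiP) => {P} [|_ [m ->]|k P _ [V [dV PV]]
  |P Q _ [V [dV PV]] _ [W [dW QW]]|P Q _ [V [dV PV]] _ [W [dW QW]]].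
- exists 1; split; first exact: GenSubalg1.
  by rewrite rmorph1.
- have [V SV] := endo_homog_restrict (@spec_Psi_homog m).
  exists V; split=> //; apply: GenSubalgX; apply: derivation_restrict SV.
  by apply: (spec_Psi_derivation A_Ft lambdaP PsiP).
- exists (k *: V); split; first exact: GenSubalgZ.
  rewrite linearZ => p; apply: etrans (congr1 _ (PV p)) _.
  by apply: seriesP => m /=; rewrite mcoeffZ.
- exists (V + W); split; first exact: GenSubalgD.
  rewrite rmorphD => p; apply: etrans (congr2 +%R (PV p) (QW p)) _.
  by apply: seriesP => m /=; rewrite mcoeffD.
- exists (V * W); split; first exact: GenSubalgM.
  rewrite rmorphM => p; apply: etrans (congr1 (S P) (QW p)) _.
  exact: PV.
Qed.

Lemma spec_diffop P : diffop alpha (S P).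
Proof. by split; [exact: spec_diffop_series lambdaP P|exact: spec_diffop_poly]. Qed.

Lemma spec_diffop_deg m P : nsym_homog m P -> diffop_deg alpha m (S P).
Proof.
move=> Pm; split; first exact: spec_diffop_series lambdaP P.
have [V [dV PV]] := spec_diffop_poly P; exists V; split=> //; split=> //.
exact: extends_homog (spec_homog Pm) PV.
Qed.

End Graded.

(** * Inversion of power series *)

Section InverseFunction.
Variables (c : variable_kind) (n : nat) (R : comNzRingType).
Implicit Types u v : series c n R.

Definition monomial_series (w : monomial c n) : series c n R :=
  Series (fun m => (m == w)%:R).

Lemma monomial_seriesM a b :
  monomial_series a * monomial_series b = monomial_series (mmul a b).
Proof.
apply: seriesP => m; set d := maxn (deg m) (maxn (deg a) (deg b)).
rewrite (series_mulE _ _ (leq_maxl _ _ : (deg m <= d)%N)) /=.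
have ad : (deg a <= d)%N by rewrite !leq_max leqnn orbT.
have bd : (deg b <= d)%N by rewrite !leq_max leqnn !orbT.
rewrite (eq_bigr (fun x => if x == a then
    \sum_(y <- monomials c n d | mmul a y == m) (y == b)%:R else 0)); last first.
  move=> x _; case: eqP => [->|_].
    by apply: eq_bigr => y _; rewrite mul1r.
  by rewrite big1 // => y _; rewrite mul0r.
rewrite -big_mkcond /= big_monomials_pred1 // big_mkcond /=.
rewrite (eq_bigr (fun y => if y == b then (mmul a b == m)%:R else 0)); last first.
  by move=> y _; case: (eqVneq y b) => [->|_]; [case: (_ == m)|rewrite if_same].
by rewrite -big_mkcond /= big_monomials_pred1 // eq_sym.
Qed.

Lemma series_monomial_zvar w : series_monomial (zvar c (n := n) R) w = monomial_series w.
Proof.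
rewrite -[in RHS](wordK w) /series_monomial; elim: (word w) => [|i s IHs].
  by rewrite big_nil of_word_nil.
by rewrite big_cons IHs -cat1s of_word_cat -monomial_seriesM.
Qed.

Lemma substitute_id u : substitute (zvar c (n := n) R) u = u.
Proof.
apply: seriesP => m; rewrite (substituteE (@order_zvar c n R) _ (leqnn _)).
rewrite (eq_bigr (fun w => if w == m then u w else 0)); last first.
  move=> w _; rewrite series_monomial_zvar /= eq_sym.
  by case: eqP; rewrite ?mulr1 ?mulr0.
by rewrite -big_mkcond /= big_monomials_pred1.
Qed.

Variable F : 'I_n -> series c n R.
Hypothesis F1 : forall i, order_ge 1 (F i).
Hypothesis F2 : forall i, order_ge 2 (F i - zvar c R i).

(** The factors z_i are replaced by F_i one at a time; each replacement costs a factor F_i - z_i of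
    order at least 2 in place of one of order at least 1. *)
Lemma order_prod s :
  order_ge (size s).+1 (\prod_(i <- s) F i - \prod_(i <- s) zvar c R i).
Proof.
elim: s => [|i s IHs]; first by rewrite !big_nil subrr.
rewrite !big_cons; set P := \prod_(j <- s) F j; set Q := \prod_(j <- s) zvar c R j.
have -> : F i * P - zvar c R i * Q = (F i - zvar c R i) * P + zvar c R i * (P - Q).
  by rewrite mulrBl mulrBr addrA subrK.
apply: order_geD; last exact: (order_geM (order_zvar R i) IHs).
suff Ps : order_ge (size s) P by exact: (order_geM (F2 i) Ps).
rewrite /P; elim: s {IHs P Q} => [|j s IHs]; first exact: order_ge0.
by rewrite big_cons; exact: (order_geM (F1 j) IHs).
Qed.

Lemma substitute_linear k u v : substitute F (k *: u + v) = k *: substitute F u + substitute F v.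
Proof.
apply: seriesP => m; rewrite /= mulr_sumr -big_split; apply: eq_bigr => w _ /=.
by rewrite mulrDl mulrA.
Qed.

Lemma substituteB u v : substitute F (u - v) = substitute F u - substitute F v.
Proof. by rewrite -!scaleN1r addrC substitute_linear addrC. Qed.

(** For w of degree at least a, F^w - z^w has order at least a + 1. *)
Lemma order_substitute_sub a u : order_ge a u -> order_ge a.+1 (substitute F u - u).
Proof.
move=> ua m ma; rewrite -[u in _ - u]substitute_id series_addE series_oppE.
rewrite (substituteE F1 _ (leqnn _)) (substituteE (@order_zvar c n R) _ (leqnn _)).
rewrite -sumrB big1 // => w _; rewrite -mulrBr.
case: (ltnP (deg w) a) => [/ua->|aw]; first by rewrite mul0r.
rewrite -series_oppE -series_addE order_prod ?mulr0 //.
exact: leq_trans ma (leq_ltn_trans aw (ltnSn _)).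
Qed.

Lemma order_ge_eq0 u : (forall a, order_ge a u) -> u = 0.
Proof. by move=> ua; apply: seriesP => m; apply: (ua (deg m).+1). Qed.

(* u |-> u(F) is the identity plus an operator raising the order, hence is
   inverted by the fixed-point iteration x |-> v - (x(F) - x). *)
Lemma substitute_bij : bijective (substitute F).
Proof.
have inj : injective (substitute F).
  move=> u v uv; apply/eqP; rewrite -subr_eq0; apply/eqP.
  set x := u - v; have x0 : substitute F x = 0 by rewrite substituteB uv subrr.
  (* Since x(F) = 0, x is the opposite of x(F) - x, so its order can be raised indefinitely. *)
  apply: order_ge_eq0; elim=> // a IHa.
  rewrite -[x]opprK; apply: order_geN; rewrite -sub0r -x0.
  exact: order_substitute_sub.
have surj v : exists u, substitute F u = v.
  (* N is introduced through an existential to keep it opaque; the iterates x below are treated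
     likewise. *)
  have [N NE] : exists N, forall y, N y = substitute F y - y by eexists.
  have NB x y : N (x - y) = N x - N y.
    by rewrite !NE substituteB !opprB addrACA [RHS]addrACA [in RHS](addrC (- x)).
  have [x xS] : exists x, forall k, x k.+1 = v - N (x k).
    by exists (fun k => iter k (fun y => v - N y) 0).
  have dx k : order_ge k (x k.+1 - x k).
    elim: k => // k IHk; rewrite [x k.+2]xS [X in _ - X]xS.
    have -> : v - N (x k.+1) - (v - N (x k)) = - N (x k.+1 - x k).
      by rewrite NB !opprB addrC subrKA.
    by rewrite NE; exact/order_geN/order_substitute_sub.
  have dxD k j : order_ge k (x (j + k)%N - x k).
    elim: j => [|j IHj]; first by rewrite subrr.
    rewrite -(subrKA (x (j + k)%N)); apply: order_geD IHj.
    by apply: order_geW (dx _); exact: leq_addl.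
  (* The limit of the iterates: from index deg m + 1 on, the coefficient of m no longer changes. *)
  pose u : series c n R := Series (fun m => x (deg m).+1 m).
  have ux k : order_ge k (u - x k).
    move=> m mk; rewrite series_addE series_oppE -[u m]/(x (deg m).+1 m).
    rewrite -[X in _ - x X m](subnK mk) -opprB.
    by rewrite -series_oppE -series_addE (dxD (deg m).+1) ?oppr0.
  exists u; apply/eqP; rewrite -subr_eq0; apply/eqP; apply: order_ge_eq0 => k.
  (* Here u(F) = u + N u and x_(k+1) = v - N x_k; both terms on the right have order at least k. *)
  have -> : substitute F u - v = (u - x k.+1) + N (u - x k).
    rewrite NB xS opprB addrACA [N (x k) - v - _]addrAC subrr add0r.
    by rewrite NE [u + _]addrC subrK.
  apply: order_geD; first by apply: order_geW (ux _).
  by rewrite NE; apply: order_geW (order_substitute_sub (ux k)).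
exists (fun v => projT1 (cid (surj v))) => v; case: cid => //= u.
exact: inj.
Qed.

End InverseFunction.

(** * Recovering F from the homogeneity of the lambda_k *)

Section Converse.
Variables (c : variable_kind) (n : nat) (K : comNzRingType).
Variables (alpha : nat) (Ft : 'I_n -> series c n (tseries K)).
Hypothesis alpha2 : (1 < alpha)%N.
Hypothesis A_Ft : A_t alpha Ft.

Lemma series_of_zpoly_zvar i : series_of_zpoly (<< zmon i >> : zpoly c n K) = zvar c K i.
Proof. by apply: seriesP => m; rewrite /= mcoeffU1 eq_sym. Qed.

Lemma zpoly_homog_zvar i : zpoly_homog 1 (<< zmon i >> : zpoly c n K).
Proof.
move=> m; rewrite mcoeffU1 /=; case: (_ =P m) => [<- _|]; last by rewrite eqxx.
by rewrite /deg size_word_of_word.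
Qed.

Lemma Lambda_nsym_homog m : nsym_homog m (Lambda K m).
Proof.
case: m => [|m] w /=.
  rewrite -[1]/(<< mone >> : {malg K[{fmonom nat}]}) mcoeffU1.
  by case: (_ =P w) => [<- _|]; rewrite ?eqxx // fm1 big_nil.
rewrite mcoeffU1; case: (_ =P w) => [<- _|]; last by rewrite eqxx.
by rewrite fmU big_seq1.
Qed.

Lemma A_t_coef0 i : tslice 0 (Ft i) = zvar c K i.
Proof.
case: A_Ft => _ [H [FH _ H0]]; apply: seriesP => m.
have Hm : tcoef (H i m) 0 = 0 := congr1 (fun u : series c n K => u m) (H0 i).
rewrite -[LHS]/(tcoef (Ft i m) 0) FH series_addE series_oppE tcoefD tcoefN Hm.
by rewrite oppr0 addr0 -tconst_zvar /= tcoef_tmonomial.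
Qed.

Lemma tz_homog_G_t : (forall i, tz_homog 1 (Ft i)) -> G_t alpha Ft.
Proof.
move=> hF; split=> //.
(* This is F_t at t = 1, which makes sense because homogeneity leaves only the power t^(deg m - 1)
   in the coefficient of m. The constant term is set to 0. *)
pose F i : series c n K :=
  Series (fun m => if deg m is k.+1 then tcoef (Ft i m) k else 0).
have F1 i : order_ge 1 (F i).
  by move=> m; rewrite ltnS leqn0 => /eqP m0; rewrite /F /= m0.
exists F; split; first split=> //.
  apply: substitute_bij => // i m; rewrite series_addE series_oppE.
  (* In degree 0 both F_i and z_i vanish. In degree 1 they agree because F_t is the identity at t =
     0. *)
  case dm : (deg m) => [|[|//]] _; rewrite /F [scoef _ m]/= dm.
    by rewrite order_zvar ?dm // subrr.
  have := congr1 (fun u : series c n K => u m) (A_t_coef0 i).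
  by rewrite -[scoef (tslice _ _) m]/(tcoef (Ft i m) 0) => ->; rewrite subrr.
move=> i; apply: seriesP => m; apply: tseriesP => k.
rewrite series_scaleE tcoef_tmonomialM mul1r [RHS]tcoef_tmonomial /F /=.
case: k => [|k]; rewrite ?subSS ?subn0.
  by case: (deg m) => [|d]; rewrite ?if_same.
case dm : (deg m) => [|d] /=; first by rewrite hF // dm.
rewrite eqSS; case: (eqVneq k d) => [->|kd] //; rewrite hF // dm add1n eqSS.
by rewrite eq_sym.
Qed.

(** Up to sign, the coefficient of t^k in the i-th component of F_t is lambda_k z_i, a homogeneous
    polynomial of degree k + 1. *)
Lemma diffop_deg_tz_homog lambda i : specialization_seq alpha Ft lambda ->
  (forall k, diffop_deg alpha k (lambda k)) -> tz_homog 1 (Ft i).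
Proof.
move=> lambdaP dlambda m k mk.
have -> : tcoef (Ft i m) k = subst_coef Ft k (zvar c K i) m.
  by rewrite subst_coef_zvar // => j; exact: A_t_order1 A_Ft j.
rewrite -(specialization_seqE k _ lambdaP) series_scaleE.
have [_ [V [[_ Vk] kV]]] := dlambda k.
rewrite -series_of_zpoly_zvar kV -[scoef _ m]/((V << zmon i >>)@_m).
have [->|Vm] := eqVneq ((V << zmon i >>)@_m) 0; first by rewrite mulr0.
by have := Vk _ _ (@zpoly_homog_zvar i) m Vm; move/eqP: mk; rewrite addnC => /[apply].
Qed.

End Converse.

Theorem proposition4p1 (K : comAlgType rat) (c : variable_kind) (n : nat)
    (hn : (0 < n)%N) (alpha : nat) (halpha : (1 < alpha)%N)
    (hN : hopf_algebra (NSym K)) (hNP : is_NSym_hopf hN)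
    (hD : hopf_algebra (der_uea c n K alpha)) (hDP : is_diffop_hopf hD)
    (Ft : 'I_n -> series c n (tseries K)) (hFt : A_t alpha Ft)
    (lambda : nat -> endo (series c n K))
    (hlambda : specialization_seq alpha Ft lambda) :
  graded_hopf_morphism hN hD (specialization lambda) <-> G_t alpha Ft.
Proof.
split=> [[_ graded _]|GFt].
  apply: tz_homog_G_t => // i; apply: (diffop_deg_tz_homog hFt i hlambda) => k.
  rewrite -(spec_Lambda hlambda k); apply: graded.
  exact: Lambda_nsym_homog.
(* The image in K of the rational number 1/(m+1). *)
pose inv m : K := (m.+1%:R^-1 : rat)%:A.
have invP m : inv m * m.+1%:R = 1.
  rewrite /inv mulr_algl -scaler_nat scalerA mulVf ?scale1r //.
  by rewrite Num.Theory.pnatr_eq0.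
have [Psi PsiP primPsi] := hNP.
have homogF i := G_t_tz_homog i GFt.
split.
- exact: (spec_diffop invP hFt hlambda homogF PsiP).
- exact: (spec_diffop_deg invP hFt hlambda homogF PsiP).
- exact: (spec_hopf invP hFt hlambda PsiP primPsi hDP).
Qed.
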